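(* Let $H$ be a connected $d$-regular hypergraph on $n$ vertices and let $\mathbb{T}_H$ be the universal cover of $H$. Then $$\lambda_2(H)\ge \rho(\mathbb{T}_H)-o_n(1),$$ where $o_n(1)$ denotes a quantity tending to $0$ as $n\to\infty$.
   Context: A hypergraph $H=(V,E)$ has a finite vertex set $V$ and a finite family $E$ of subsets of $V$ (edges). The degree of a vertex is the number of edges containing it; $H$ is $d$-regular if every vertex has degree $d$. The adjacency matrix $A(H)$ has $(u,v)$-entry the number of edges containing both $u$ and $v$ for $u\ne v$, and $0$ on the diagonal; its eigenvalues are $\lambda_1(H)\ge\lambda_2(H)\ge\cdots\ge\lambda_n(H)$. The incidence graph $B_H$ is the bipartite graph on $V\cup E$ with $v\sim e$ iff $v\in e$. The universal cover $\mathbb{T}_{B_H}$ of the (connected) graph $B_H$ is the infinite tree whose vertices are the non-backtracking walks in $B_H$ starting at a fixed root vertex $v_0\in V$ (of all lengths $\ge 0$), two walks being adjacent when one extends the other by one step. The universal cover $\mathbb{T}_H$ of $H$ is the (infinite) hypergraph whose vertices are the walks in $\mathbb{T}_{B_H}$ ending at vertices of $H$, and which has one edge for each walk $w$ ending at an edge of $H$, namely the set of vertices of $\mathbb{T}_H$ adjacent to $w$ in $\mathbb{T}_{B_H}$ (up to isomorphism this is independent of $v_0$). Its adjacency operator on $\ell^2(V(\mathbb{T}_H))$ is $(Ax)_u=\sum_{e\ni u}\sum_{v\in e,v\ne u}x_v$, and $\rho(\mathbb{T}_H)$ is its spectral radius (equivalently its operator norm).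
   Formalization: The quantity o_n(1) may depend on the universal cover: for each d and each cover T, one o_n(1) serves all connected d-regular H on n ≥ 2 vertices with T_H isomorphic to T; with only d fixed the claim fails (a single edge on n vertices: λ_2 = -1, ρ = n-1). *)

(* Defs.v *)
From HB Require Import structures.
From mathcomp Require Import all_boot all_order all_algebra.
From mathcomp Require Import all_classical all_reals all_analysis.
From mathcomp Require Import complex.

Set Implicit Arguments.
Unset Strict Implicit.
Unset Printing Implicit Defensive.

Import Order.TTheory GRing.Theory Num.Theory.

Local Open Scope classical_set_scope.
Local Open Scope ring_scope.

Section FiniteHypergraph.
Variables V E : finType.

(* A finite hypergraph is an indexed family of subsets, so repeated edges are
   allowed. *)
Variable H : E -> {set V}.

Definition hdegree (v : V) : nat := #|[set e : E | v \in H e]%SET|.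

Definition hregular (d : nat) : Prop := forall v : V, hdegree v = d.

Definition incidence : rel (V + E) := fun x y =>
  match x, y with
  | inl v, inr e => v \in H e
  | inr e, inl v => v \in H e
  | _, _ => false
  end.

Definition hconnected : Prop := forall x y : V + E, connect incidence x y.

Definition hadjacency (R : nzRingType) : 'M[R]_#|V| :=
  \matrix_(i, j) if i == j then 0 else
    #|[set e : E | (enum_val i \in H e) && (enum_val j \in H e)]%SET|%:R.

End FiniteHypergraph.

(* The eigenvalues of A, with multiplicity, in nonincreasing order, provided the
   characteristic polynomial of A splits over R, as it does for a symmetric A;
   the list of its roots is unique up to permutation. *)
Definition eigenvalues (R : realType) (n : nat) (A : 'M[R]_n) : seq R :=
  sort (fun x y => y <= x)
    (xget [::] [set s | char_poly A = \prod_(x <- s) ('X - x%:P)]).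

(* Indexed from 1: hlambda R H 1 is the largest eigenvalue. *)
Definition hlambda (R : realType) (V E : finType) (H : E -> {set V})
    (k : nat) : R :=
  nth 0 (eigenvalues (hadjacency H R)) k.-1.

Record hypergraph := Hypergraph {
  hvert : choiceType;
  hedge : choiceType;
  hmem : hedge -> set hvert
}.

Definition hiso (S T : hypergraph) : Prop :=
  exists (f : hvert S -> hvert T) (g : hedge S -> hedge T),
    [/\ bijective f, bijective g &
        forall e v, hmem (g e) (f v) <-> hmem e v].

Section UniversalCover.
Variables V E : finType.
Variable H : E -> {set V}.
Variable v0 : V.

Fixpoint nonbacktracking (T : eqType) (s : seq T) : bool :=
  match s with
  | x :: ((_ :: z :: _) as s') => (x != z) && nonbacktracking s'
  | _ => true
  end.

(* p stands for the walk inl v0 :: p of length size p. *)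
Definition nbwalk := {p : seq (V + E) |
  path (incidence H) (inl v0) p && nonbacktracking (inl v0 :: p)}.

Definition walk_end (w : nbwalk) : V + E := last (inl v0) (val w).

Definition extends (w w' : nbwalk) : Prop :=
  exists x, val w' = rcons (val w) x.

Definition cover_adj (w w' : nbwalk) : Prop := extends w w' \/ extends w' w.

Definition ends_at_vertex (w : nbwalk) : bool :=
  if walk_end w is inl _ then true else false.

Definition ends_at_edge (w : nbwalk) : bool :=
  if walk_end w is inr _ then true else false.

Definition universal_cover : hypergraph :=
  @Hypergraph {w : nbwalk | ends_at_vertex w} {w : nbwalk | ends_at_edge w}
    (fun e => [set u | cover_adj (val e) (val u)]).

End UniversalCover.

Section SpectralRadius.
Variable R : realType.
Variable T : hypergraph.

Definition ell2_sqnorm (x : hvert T -> R[i]) : \bar R :=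
  \esum_(v in [set: hvert T]) (Normc.normc (x v) ^+ 2)%:E.

Definition ell2 : set (hvert T -> R[i]) :=
  [set x | (ell2_sqnorm x < +oo)%E].

(* The sums are finite when T is locally finite, as every universal cover of a
   finite hypergraph is; sums of infinite support are 0 by convention. *)
Definition adj_op (x : hvert T -> R[i]) : hvert T -> R[i] := fun u =>
  \sum_(e \in [set e : hedge T | hmem e u])
    \sum_(v \in [set v | hmem e v /\ v <> u]) x v.

Definition adj_shift (z : R[i]) (x : hvert T -> R[i]) : hvert T -> R[i] :=
  fun u => adj_op x u - z * x u.

(* The second condition says that the inverse of A - z on l^2 is bounded. *)
Definition resolvent_set : set R[i] := [set z |
  set_bij ell2 ell2 (adj_shift z) /\
  exists c : R, forall x, ell2 x ->
    (ell2_sqnorm x <= c%:E * ell2_sqnorm (adj_shift z x))%E].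

Definition spectrum : set R[i] := ~` resolvent_set.

Definition spectral_radius : \bar R :=
  ereal_sup [set (Normc.normc z)%:E | z in spectrum].

End SpectralRadius.

(* Main.v *)
Require Import Defs.
From HB Require Import structures.
From mathcomp Require Import all_boot all_order all_algebra.
From mathcomp Require Import all_classical all_reals all_analysis.
From mathcomp Require Import complex.
From mathcomp Require Import ring lra zify.

Import Order.TTheory GRing.Theory Num.Theory.
Import numFieldNormedType.Exports.

Local Open Scope classical_set_scope.
Local Open Scope ring_scope.

(** The spectral radius of the cover is at most any bound [mu] for the quadratic
    form of its adjacency operator on finitely supported functions (Neumann
    series). For the least such [mu] and [c < mu], some finitely supported [f] on
    the cover has Rayleigh quotient above [c]. Rerooting the tree of walks shows
    that such an [f] exists in the ball of a fixed radius [r] around every vertex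
    of the cover, because up to isomorphism the cover has only finitely many
    roots. Its image [F v = sqrt (sum of f^2 over the lifts of v)] in any [H] with
    this cover has the same norm and, by a weighted AM-GM inequality, a quadratic
    form at least as large. Degrees in [H] are bounded in terms of the cover, so a
    large [H] has two vertices at distance more than [2 r + 1]; the two images
    around them are orthogonal and not adjacent, and Courant-Fischer gives
    [lambda_2 >= c]. *)

(** * Nonbacktracking walks and the universal cover *)

(** Multiplicities are dropped: in a universal cover two vertices share at most one edge
    ([hmem_common]), so this relation determines the adjacency operator. *)
Definition hadj (G : hypergraph) (u v : hvert G) : Prop :=
  u <> v /\ exists e : hedge G, hmem e u /\ hmem e v.

Lemma hadj_sym (G : hypergraph) (u v : hvert G) : hadj G u v -> hadj G v u.
Proof. by case=> uv [e [eu ev]]; split; [exact/nesym|exists e]. Qed.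

(** [nonbacktracking] recurses from the front, while walks of the cover grow at the end. *)
Lemma nonbacktracking_rcons3 (T : eqType) (s : seq T) (a b c : T) :
  nonbacktracking (rcons (rcons (rcons s a) b) c) =
  nonbacktracking (rcons (rcons s a) b) && (a != c).
Proof.
elim: s => [|x s IHs] /=; first by rewrite andbT.
by case: s IHs => [|y [|z s]] /= IHs; rewrite ?IHs ?andbT ?andbA.
Qed.

Lemma nonbacktracking_rcons (T : eqType) (s : seq T) (c : T) :
  nonbacktracking (rcons s c) -> nonbacktracking s.
Proof.
case/lastP: s => [//|s b]; case/lastP: s => [//|s a].
by rewrite nonbacktracking_rcons3 => /andP[].
Qed.

Lemma nonbacktracking_uniq (T : eqType) (s : seq T) : uniq s -> nonbacktracking s.
Proof.
elim: s => [//|x [|y [|z s]] IHs] // /andP[xs us].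
rewrite -[nonbacktracking _]/((x != z) && nonbacktracking [:: y, z & s]) IHs//.
by rewrite andbT; apply: contraNneq xs => ->; rewrite !inE eqxx orbT.
Qed.

Section Walks.
Context {V E : finType}.
Variable H : E -> {set V}.
Implicit Types (x y z : V + E) (p q w : seq (V + E)).

Lemma incidence_sym x y : incidence H x y = incidence H y x.
Proof. by case: x y => [?|?] []. Qed.

(** The root may be any node of the incidence graph, edges included, since rerooting passes through
    both kinds. *)
Definition nbw x p := path (incidence H) x p && nonbacktracking (x :: p).

(* Adjacency in the tree of nonbacktracking walks from a fixed root. *)
Definition sadj p q : Prop :=
  (exists z, q = rcons p z) \/ (exists z, p = rcons q z).

Lemma sadj_sym p q : sadj p q -> sadj q p.
Proof. by case; [right|left]. Qed.

Lemma nbw_rcons x p y : nbw x (rcons p y) -> nbw x p.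
Proof.
rewrite /nbw rcons_path -rcons_cons => /andP[/andP[-> _]].
exact: nonbacktracking_rcons.
Qed.

Lemma nbw_rcons2 x p y z : nbw x (rcons (rcons p y) z) -> last x p != z.
Proof.
by rewrite /nbw -!rcons_cons (lastI x p) nonbacktracking_rcons3 => /andP[_ /andP[]].
Qed.

Lemma sadj_incidence x p q : nbw x p -> nbw x q -> sadj p q ->
  incidence H (last x p) (last x q).
Proof.
move=> wp wq [[z qE]|[z pE]].
  by move: wq; rewrite qE last_rcons /nbw rcons_path => /andP[/andP[]].
rewrite incidence_sym.
by move: wp; rewrite pE last_rcons /nbw rcons_path => /andP[/andP[]].
Qed.

(** Local injectivity of the covering map. Two extensions of [w] differ in their last letter, and by
    nonbacktracking no extension ends where the parent of [w] does. *)
Lemma sadj_last_inj x w p q : nbw x p -> nbw x q ->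
  sadj w p -> sadj w q -> last x p = last x q -> p = q.
Proof.
move=> wp wq [[a pE]|[a pE]] [[b qE]|[b qE]].
- by rewrite pE qE !last_rcons => ->.
- move: wp; rewrite pE qE => /nbw_rcons2; rewrite last_rcons => /eqP + e.
  by rewrite e.
- move: wq; rewrite qE pE => /nbw_rcons2; rewrite last_rcons => /eqP.
  by [].
- by move: pE; rewrite qE => /rcons_inj[].
Qed.

(** A tree has no 4-cycle: parents are unique, and lengths of adjacent walks differ by one. *)
Lemma sadj_unique w w' p q : p <> q ->
  sadj w p -> sadj w q -> sadj w' p -> sadj w' q -> w = w'.
Proof.
move=> pq wp wq w'p w'q.
have sz r s : sadj r s -> (size s = (size r).+1 \/ size r = (size s).+1)%N.
  by case=> -[z ->]; rewrite size_rcons; [left|right].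
case: wp => -[a aE]; case: w'p => -[b bE].
- by move: aE; rewrite bE => /rcons_inj[].
- case: w'q => -[c cE]; last by case: pq; move: cE; rewrite bE => /rcons_inj[].
  have := sz _ _ wq; rewrite cE bE aE !size_rcons; lia.
- case: wq => -[c cE]; last by case: pq; move: cE; rewrite aE => /rcons_inj[].
  have := sz _ _ w'q; rewrite cE aE bE !size_rcons; lia.
- case: wq => -[c cE]; last by case: pq; move: cE; rewrite aE => /rcons_inj[].
  case: (w'q) => -[e eE]; last by case: pq; move: eE; rewrite bE => /rcons_inj[].
  by move: cE; rewrite eE => /rcons_inj[].
Qed.

(** Local surjectivity of the covering map: go back to the parent if it ends at [y], otherwise
    extend by [y]. *)
Lemma sadj_lift x w y : nbw x w -> incidence H (last x w) y ->
  exists p, [/\ nbw x p, sadj w p & last x p = y].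
Proof.
case/lastP: w => [|w z] ww iy.
  by exists [:: y]; split => //; [rewrite /nbw /= iy|left; exists y].
have [wy|wy] := eqVneq (last x w) y.
  by exists w; split => //; [exact: nbw_rcons ww|right; exists z].
exists (rcons (rcons w z) y); split; [|by left; exists y|by rewrite last_rcons].
move: ww; rewrite /nbw [path _ _ (rcons (rcons _ _) _)]rcons_path iy andbT.
case/andP=> ->; rewrite -!rcons_cons (lastI x w) nonbacktracking_rcons3.
by move=> ->.
Qed.

Lemma connect_nbw x y : connect (incidence H) x y ->
  exists2 p, nbw x p & last x p = y.
Proof.
case/connectP => p pp ->; case: (shortenP pp) => q qp uq _.
by exists q => //; rewrite /nbw qp nonbacktracking_uniq.
Qed.

(* Moving the root of the tree from the neighbour b of a to a. *)
Definition reroot a b p :=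
  if p is z :: p' then if z == a then p' else b :: p else [:: b].

Lemma reroot_nbw a b p : incidence H a b -> nbw b p -> nbw a (reroot a b p).
Proof.
move=> ab; case: p => [|z p] /=; first by rewrite /nbw /= ab.
have [->|za] := eqVneq z a.
  by case: p => [//|c p]; rewrite /nbw /= => /andP[/andP[_ ->]] /andP[_ ->].
by rewrite /nbw /= ab eq_sym za.
Qed.

Lemma rerootK a b p : nbw b p -> reroot b a (reroot a b p) = p.
Proof.
case: p => [|z p] /=; first by rewrite eqxx.
have [->|za] /= := eqVneq z a; last by rewrite eqxx.
(* By nonbacktracking the letter after [a] is not [b], so the second reroot prepends [a] again. *)
case: p => [//|c p]; rewrite /nbw => /andP[_] /= /andP[bc _].
by rewrite eq_sym (negbTE bc).
Qed.

Lemma last_reroot a b p : nbw b p -> last a (reroot a b p) = last b p.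
Proof. by case: p => [|z p] //= _; case: eqVneq => [->|]. Qed.

Lemma reroot_sadj a b p q : sadj p q -> sadj (reroot a b p) (reroot a b q).
Proof.
wlog: p q / exists z, q = rcons p z => [wl|[z -> _]].
  by case=> pq; [apply: wl => //; left|apply/sadj_sym/wl => //; left].
case: p => [|c p] /=.
  by case: eqP => _; [right; exists b|left; exists z].
by case: eqP => _; left; exists z.
Qed.

(** An isomorphism of trees that keeps endpoints is a pair of these, one in each direction. *)
Definition walk_morph x y (f g : seq (V + E) -> seq (V + E)) : Prop :=
  (forall q, nbw x q -> [/\ nbw y (f q), g (f q) = q & last y (f q) = last x q]) /\
  (forall q q', nbw x q -> nbw x q' -> sadj q q' -> sadj (f q) (f q')).

Lemma reroot_walk_morph a b : incidence H a b ->
  walk_morph b a (reroot a b) (reroot b a).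
Proof.
by move=> ab; split => [q bq|*]; [split|];
  rewrite ?reroot_nbw ?rerootK ?last_reroot//; exact: reroot_sadj.
Qed.

Lemma walk_morph_comp x y z f g f' g' : walk_morph x y f g ->
  walk_morph y z f' g' -> walk_morph x z (f' \o f) (g \o g').
Proof.
move=> [f1 f2] [f1' f2']; split=> [q xq|q q' xq xq' qq'] /=.
  by have [yq gq lq] := f1 _ xq; have [zq gq' lq'] := f1' _ yq;
    rewrite gq' gq lq' lq.
by apply: f2'; [case: (f1 _ xq)|case: (f1 _ xq')|exact: f2].
Qed.

(** The root moves along [p] one incidence at a time by [reroot]; the empty walk at the far end
    corresponds to [p] itself. *)
Lemma reroot_walk x p : nbw x p -> exists f g,
  [/\ walk_morph (last x p) x f g, walk_morph x (last x p) g f & f [::] = p].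
Proof.
elim: p x => [|y p IHp] x; first by exists id, id; split.
move=> xyp; have xy : incidence H x y by case/andP: xyp => /= /andP[].
have yp : nbw y p.
  move: xyp; rewrite /nbw /= => /andP[/andP[_ ->]].
  by case: p {IHp} => [//|z p] /andP[_ ->].
have [f [g [fg gf f0]]] := IHp y yp.
exists (reroot x y \o f), (g \o reroot y x); split.
- exact: (walk_morph_comp _ _ _ _ _ _ _ fg (reroot_walk_morph _ _ xy)).
- apply: (walk_morph_comp _ _ _ _ _ _ _ (reroot_walk_morph _ _ _) gf).
  by rewrite incidence_sym.
- rewrite /= f0; case: p xyp {IHp yp fg gf f0} => [//|z p].
  by rewrite /nbw /= eq_sym => /andP[_ /andP[/negbTE-> _]].
Qed.

End Walks.

(** * Vertices and edges of the cover as walks *)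

Section Cover.
Context {V E : finType}.
Variables (H : E -> {set V}) (v0 : V).
Let C := universal_cover H v0.

Definition vseq (u : hvert C) : seq (V + E) := val (val u).
Definition eseq (e : hedge C) : seq (V + E) := val (val e).

(** The default [v0] is never reached ([vend_last]). *)
Definition vend (u : hvert C) : V :=
  if last (inl v0) (vseq u) is inl v then v else v0.

Lemma vend_last u : last (inl v0) (vseq u) = inl (vend u).
Proof.
case: u => w wv; rewrite /vend /vseq /=.
by move: wv; rewrite /ends_at_vertex /walk_end; case: last.
Qed.

Lemma eend_last e : exists a, last (inl v0) (eseq e) = inr a.
Proof.
case: e => w wv; rewrite /eseq /=.
by move: wv; rewrite /ends_at_edge /walk_end; case: last => // a; exists a.
Qed.

Lemma vseq_nbw u : nbw H (inl v0) (vseq u). Proof. exact: valP (val u). Qed.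
Lemma eseq_nbw e : nbw H (inl v0) (eseq e). Proof. exact: valP (val e). Qed.

Lemma vseq_inj : injective vseq.
Proof. by move=> u v /val_inj/val_inj. Qed.
Lemma eseq_inj : injective eseq.
Proof. by move=> u v /val_inj/val_inj. Qed.

Lemma vseq_ex p v : nbw H (inl v0) p -> last (inl v0) p = inl v ->
  exists2 u, vseq u = p & vend u = v.
Proof.
move=> wp lp; pose w : nbwalk H v0 := exist _ p wp.
have wv : ends_at_vertex w by rewrite /ends_at_vertex /walk_end /= lp.
by exists (exist _ w wv) => //; rewrite /vend /vseq /= lp.
Qed.

Lemma eseq_ex p e : nbw H (inl v0) p -> last (inl v0) p = inr e ->
  exists a, eseq a = p.
Proof.
move=> wp lp; pose w : nbwalk H v0 := exist _ p wp.
have wv : ends_at_edge w by rewrite /ends_at_edge /walk_end /= lp.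
by exists (exist _ w wv).
Qed.

Lemma hmemE (e : hedge C) (u : hvert C) : hmem e u <-> sadj (eseq e) (vseq u).
Proof.
rewrite /hmem /= /cover_adj /extends.
by split; case=> -[x]; [left|right|left|right]; exists x.
Qed.

(** Brings adjacency down to plain sequences, on which rerooting acts. *)
Lemma coverP u v : hadj C u v <->
  vseq u <> vseq v /\ exists w a, [/\ nbw H (inl v0) w,
    last (inl v0) w = inr a, sadj w (vseq u) & sadj w (vseq v)].
Proof.
split=> -[uv].
  case=> e [/hmemE eu /hmemE ev]; split; first by move/vseq_inj.
  by have [a ea] := eend_last e; exists (eseq e), a; split; rewrite ?eseq_nbw.
case=> w [a [ww wa wu wv]]; split; first by move=> e; apply: uv; rewrite e.
have [e eE] := eseq_ex _ _ ww wa.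
by exists e; split; apply/hmemE; rewrite eE.
Qed.

Lemma hmem_common u v e e' : u <> v -> @hmem C e u -> hmem e v -> hmem e' u ->
  hmem e' v -> e = e'.
Proof.
move=> uv /hmemE eu /hmemE ev /hmemE eu' /hmemE ev'; apply: eseq_inj.
by apply: (sadj_unique _ _ _ _ _ eu ev) => //; move/vseq_inj.
Qed.

Lemma cover_step u v : hadj C u v -> exists a w,
  [/\ nbw H (inl v0) w, last (inl v0) w = inr a, sadj w (vseq u) /\ sadj w (vseq v),
      vend u \in H a /\ vend v \in H a & vend u != vend v].
Proof.
case/coverP => uv [w [a [ww wa wu wv]]]; exists a, w; split => //.
  have := sadj_incidence _ _ _ _ ww (vseq_nbw u) wu.
  have := sadj_incidence _ _ _ _ ww (vseq_nbw v) wv.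
  by rewrite !vend_last wa.
apply/eqP => e; apply: uv.
apply: (sadj_last_inj _ _ _ _ _ (vseq_nbw u) (vseq_nbw v) wu wv).
by rewrite !vend_last e.
Qed.

Lemma vend_surj : hconnected H -> forall v, exists u, vend u = v.
Proof.
move=> cH v; have [p wp lp] := connect_nbw _ _ _ (cH (inl v0) (inl v)).
by have [u _ uv] := vseq_ex _ _ wp lp; exists u.
Qed.

Lemma cover_lift u v a : vend u \in H a -> v \in H a -> vend u != v ->
  exists2 u', vend u' = v & hadj C u u'.
Proof.
move=> ua va uv.
have [|w [ww uw wa]] := sadj_lift H (inl v0) (vseq u) (inr a) (vseq_nbw u).
  by rewrite vend_last.
have [|p [wp wp' pv]] := sadj_lift H (inl v0) w (inl v) ww.
  by rewrite wa.
have [u' u'E u'v] := vseq_ex _ _ wp pv; exists u' => //.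
apply/coverP; split; first by move/vseq_inj => e; rewrite e u'v eqxx in uv.
by exists w, a; split; rewrite ?u'E//; exact: sadj_sym.
Qed.

(* The projection is injective on pairs (incident edge, neighbour through it). *)
Lemma cover_sum_le (R : numDomainType) (F : V -> R) u (s : seq (hvert C)) :
  uniq s -> (forall v, 0 <= F v) ->
  \sum_(v <- s | `[< hadj C u v >]) F (vend v) <=
  \sum_(a | vend u \in H a) \sum_(v in H a | v != vend u) F v.
Proof.
move=> us F0; rewrite pair_big_dep /= -[leLHS]big_filter.
set t := [seq v <- s | `[< hadj C u v >]].
have tP v : v \in t -> hadj C u v by rewrite mem_filter => /andP[/asboolP].
have {}ut : uniq t by rewrite filter_uniq.
have [t0|[v1 v1t]] : t = [::] \/ exists v1, v1 \in t.
    by case: (t) => [|v1 t']; [left|right; exists v1; rewrite inE eqxx].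
  by rewrite t0 big_nil sumr_ge0.
have [a0 _] := cover_step _ _ (tP _ v1t).
have /choice[h hP] : forall v, exists a, v \in t -> exists w,
    [/\ nbw H (inl v0) w, last (inl v0) w = inr a,
      sadj w (vseq u) /\ sadj w (vseq v),
      vend u \in H a /\ vend v \in H a & vend u != vend v].
  move=> v; have [vt|] := boolP (v \in t); last by exists a0.
  by have [a ?] := cover_step _ _ (tP _ vt); exists a.
pose k v := (h v, vend v).
(* Local injectivity twice: the edge walk next to [u] is determined by its endpoint, then the
   neighbour through it by [vend]. *)
have kinj : {in t &, injective k}.
  move=> v v' /hP[w [ww wa [wu wv] _ _]] /hP[w' [ww' wa' [wu' wv'] _ _]] [hvv' vv'].
  have ww'E : w = w'.
    apply: (sadj_last_inj H _ _ _ _ ww ww' (sadj_sym _ _ wu) (sadj_sym _ _ wu')).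
    by rewrite wa wa' hvv'.
  apply: vseq_inj; move: wv'; rewrite -ww'E => wv'.
  apply: (sadj_last_inj _ _ _ _ _ (vseq_nbw v) (vseq_nbw v') wv wv').
  by rewrite !vend_last vv'.
rewrite -(big_map k xpredT (fun x => F x.2)).
have uk : uniq (map k t) by rewrite map_inj_in_uniq.
rewrite big_uniq //= [leRHS](bigID (mem (map k t))) /=.
rewrite [X in X + _](_ : _ = \sum_(i in map k t) F i.2); last first.
  apply: eq_bigl => -[a v] /=; rewrite andbC; case: (boolP (_ \in _)) => //=.
  case/mapP => v' /hP[w [_ _ _ [uh vh] uv]] [-> ->].
  by rewrite uh vh eq_sym uv.
by rewrite lerDl sumr_ge0.
Qed.

End Cover.

(** * Spectral radius and the quadratic form *)

(** An upper bound for the Rayleigh quotients of finitely supported functions. It also controls the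
    form from below, because passing to absolute values does not decrease the form. *)
Definition form_bound (R : realType) (G : hypergraph) (c : R) : Prop :=
  forall (s : seq (hvert G)) (f : hvert G -> R), uniq s ->
    \sum_(u <- s) \sum_(v <- s | `[< hadj G u v >]) f u * f v <=
    c * \sum_(u <- s) f u ^+ 2.

Lemma sum_subset_uniq (R : nmodType) (T : eqType) (s S : seq T) (F : T -> R) :
  uniq s -> uniq S -> {subset s <= S} ->
  \sum_(u <- S | u \in s) F u = \sum_(u <- s) F u.
Proof.
move=> us uS sS; rewrite -big_filter; apply: perm_big; apply: uniq_perm => //.
  exact: filter_uniq.
move=> x; rewrite mem_filter; case: (boolP (x \in s)) => //= /sS.
by [].
Qed.

(** * Squared modulus and componentwise limits of complex numbers *)

Section ComplexSquare.
Context {R : realType}.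
Implicit Types z w : R[i].

Definition nsq z : R := complex.Re z ^+ 2 + complex.Im z ^+ 2.

Lemma nsq_normc z : Normc.normc z ^+ 2 = nsq z.
Proof. by case: z => a b; rewrite /nsq /= sqr_sqrtr// addr_ge0 ?sqr_ge0. Qed.

Lemma nsq_ge0 z : 0 <= nsq z. Proof. by rewrite addr_ge0 ?sqr_ge0. Qed.

Lemma nsqM z w : nsq (z * w) = nsq z * nsq w.
Proof. by case: z w => [a b] [c d]; rewrite /nsq /=; ring. Qed.

Lemma nsqX z n : nsq (z ^+ n) = nsq z ^+ n.
Proof.
elim: n => [|n IHn]; last by rewrite !exprS nsqM IHn.
by rewrite !expr0 /nsq /= expr0n /= addr0 expr1n.
Qed.

Lemma nsq0 : nsq 0 = 0. Proof. by rewrite /nsq /= expr0n /= addr0. Qed.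

Lemma nsq_eq0 z : nsq z = 0 -> z = 0.
Proof. by rewrite -nsq_normc => /eqP; rewrite sqrf_eq0 => /eqP/Normc.eq0_normc. Qed.

Lemma nsqN z : nsq (- z) = nsq z.
Proof. by case: z => a b; rewrite /nsq /= !sqrrN. Qed.

Lemma nsqV z : nsq z^-1 = (nsq z)^-1.
Proof. by rewrite -!nsq_normc Normc.normcV exprVn. Qed.

(** For each real component the gap between the two sides is [(e * x + y) ^+ 2 / e]. *)
Lemma nsqB_le (e : R) z w : 0 < e ->
  nsq (z - w) <= (1 + e) * nsq z + (1 + e^-1) * nsq w.
Proof.
case: z w => [a b] [c d] e0; rewrite /nsq /=.
have key (x y : R) : (x - y) ^+ 2 <= (1 + e) * x ^+ 2 + (1 + e^-1) * y ^+ 2.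
  rewrite -subr_ge0; have -> : (1 + e) * x ^+ 2 + (1 + e^-1) * y ^+ 2 - (x - y) ^+ 2
      = (e * x + y) ^+ 2 / e by field; rewrite gt_eqF.
  by rewrite divr_ge0 ?sqr_ge0 ?ltW.
by have := key a c; have := key b d; lra.
Qed.

Lemma Re_sum (I : Type) (r : seq I) (F : I -> R[i]) :
  complex.Re (\sum_(i <- r) F i) = \sum_(i <- r) complex.Re (F i).
Proof. by apply: big_morph => // -[a b] [c d]. Qed.

Lemma Im_sum (I : Type) (r : seq I) (F : I -> R[i]) :
  complex.Im (\sum_(i <- r) F i) = \sum_(i <- r) complex.Im (F i).
Proof. by apply: big_morph => // -[a b] [c d]. Qed.

Definition cvgc (u : nat -> R[i]) (l : R[i]) : Prop :=
  (complex.Re (u n) @[n --> \oo] --> complex.Re l) /\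
  (complex.Im (u n) @[n --> \oo] --> complex.Im l).

Lemma cvgc_unique u l l' : cvgc u l -> cvgc u l' -> l = l'.
Proof.
case: l l' => [a b] [a' b'] [/= ua ub] [/= ua' ub'].
by congr Complex; [apply: cvg_unique ua ua'|apply: cvg_unique ub ub'];
  exact: Rhausdorff.
Qed.

Lemma ReB z w : complex.Re (z - w) = complex.Re z - complex.Re w.
Proof. by case: z w => [a b] []. Qed.

Lemma ImB z w : complex.Im (z - w) = complex.Im z - complex.Im w.
Proof. by case: z w => [a b] []. Qed.

Lemma ReM z w : complex.Re (z * w) =
  complex.Re z * complex.Re w - complex.Im z * complex.Im w.
Proof. by case: z w => [a b] []. Qed.

Lemma ImM z w : complex.Im (z * w) =
  complex.Re z * complex.Im w + complex.Im z * complex.Re w.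
Proof. by case: z w => [a b] []. Qed.

Lemma cvgcB u v l k : cvgc u l -> cvgc v k -> cvgc (fun n => u n - v n) (l - k).
Proof.
move=> [u1 u2] [v1 v2]; split; rewrite ?ReB ?ImB.
  by under eq_fun do rewrite ReB; exact: cvgB.
by under eq_fun do rewrite ImB; exact: cvgB.
Qed.

Lemma cvgcZ z u l : cvgc u l -> cvgc (fun n => z * u n) (z * l).
Proof.
move=> [u1 u2]; split; rewrite ?ReM ?ImM.
  by under eq_fun do rewrite ReM; apply: cvgB; apply: cvgMr.
by under eq_fun do rewrite ImM; apply: cvgD; apply: cvgMr.
Qed.

Lemma cvgc_sum (I : Type) (r : seq I) (u : I -> nat -> R[i]) (l : I -> R[i]) :
  (forall i, cvgc (u i) (l i)) ->
  cvgc (fun n => \sum_(i <- r) u i n) (\sum_(i <- r) l i).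
Proof.
move=> ul; split; rewrite ?Re_sum ?Im_sum.
  under eq_fun do rewrite Re_sum.
  by apply: cvg_big => [|i _]; [exact: add_continuous|case: (ul i)].
under eq_fun do rewrite Im_sum.
by apply: cvg_big => [|i _]; [exact: add_continuous|case: (ul i)].
Qed.

Lemma cvgc_series (u : nat -> R[i]) (C q : R) : 0 <= q < 1 -> 0 <= C ->
  (forall n, nsq (u n) <= (C * q ^+ n) ^+ 2) ->
  exists l, cvgc (fun n => \sum_(i < n) u i) l.
Proof.
move=> /andP[q0 q1] C0 uC.
have gcv : cvgn (series (geometric C q)).
  by apply: is_cvg_geometric_series; rewrite ger0_norm.
have key (v : nat -> R) : (forall n, v n ^+ 2 <= nsq (u n)) -> cvgn (series v).
  move=> vu; apply: normed_cvg; apply: series_le_cvg gcv => n //=.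
    by rewrite mulr_ge0 ?exprn_ge0.
  rewrite -[leRHS]ger0_norm ?mulr_ge0 ?exprn_ge0// -ler_sqr ?nnegrE//.
  by rewrite !real_normK ?num_real// (le_trans (vu n)).
have reC := key (fun n => complex.Re (u n)) (fun n => ltac:(by rewrite lerDl sqr_ge0)).
have imC := key (fun n => complex.Im (u n)) (fun n => ltac:(by rewrite lerDr sqr_ge0)).
exists (limn (series (fun n => complex.Re (u n))) +i*
        limn (series (fun n => complex.Im (u n))))%C.
split => /=.
  rewrite (_ : (fun n => _) = series (fun n => complex.Re (u n))); first exact: reC.
  by apply/funext => n; rewrite /series /= big_mkord Re_sum.
rewrite (_ : (fun n => _) = series (fun n => complex.Im (u n))); first exact: imC.
by apply/funext => n; rewrite /series /= big_mkord Im_sum.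
Qed.

Lemma cvgc_geometric0 (u : nat -> R[i]) (C q : R) : 0 <= q < 1 -> 0 <= C ->
  (forall n, nsq (u n) <= (C * q ^+ n) ^+ 2) -> cvgc u 0.
Proof.
move=> /andP[q0 q1] C0 uC.
have g0 : geometric C q x @[x --> \oo] --> (0 : R).
  by apply: cvg_geometric; rewrite ger0_norm.
have key (v : nat -> R) : (forall n, v n ^+ 2 <= nsq (u n)) -> v n @[n --> \oo] --> (0 : R).
  move=> vu; apply/norm_cvg0P.
  apply: (@squeeze_cvgr _ _ _ R (fun=> 0) (geometric C q)) g0; last exact: cvg_cst.
  near=> n; rewrite normr_ge0 /=.
  rewrite -[leRHS]ger0_norm ?mulr_ge0 ?exprn_ge0// -ler_sqr ?nnegrE//.
  by rewrite !real_normK ?num_real// (le_trans (vu n)).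
by split; apply: key => n; rewrite /nsq ?lerDl ?lerDr sqr_ge0.
Unshelve. all: by end_near.
Qed.

End ComplexSquare.

(** * Resolvent of the adjacency operator outside a form bound *)

Section Resolvent.
Context {R : realType} {G : hypergraph}.
Let VG := hvert G.
Variable nb : VG -> seq VG.
Hypothesis nb_uniq : forall u, uniq (nb u).
Hypothesis nbP : forall u v, v \in nb u <-> hadj G u v.
Hypothesis adj_opE : forall (x : VG -> R[i]) u, adj_op x u = \sum_(v <- nb u) x v.

(** The form bound controls the operator norm. With [y = A g] on [s], polarization writes
    [(2 / c) (<y, A g> + <g, A y>)] as the form at [g + y / c] minus the form at [g - y / c]. The
    subtracted form is at least minus the form at [|g - y / c|], so [form_bound] applies to both. *)
Lemma adjacency_sum_sqr_le (c : R) (f : VG -> R) (s : seq VG) :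
  0 < c -> form_bound R G c -> uniq s ->
  \sum_(u <- s) (\sum_(v <- nb u) f v) ^+ 2 <=
  c ^+ 2 * \sum_(v <- undup (flatten (map nb s))) f v ^+ 2.
Proof.
move=> c0 cG us; set t := undup _; set Y := \sum_(u <- s) _; set X := \sum_(v <- t) _.
pose S := undup (s ++ t).
have uS : uniq S by exact: undup_uniq.
have ut : uniq t by exact: undup_uniq.
have sS : {subset s <= S} by move=> x xs; rewrite mem_undup mem_cat xs.
have tS : {subset t <= S} by move=> x xs; rewrite mem_undup mem_cat xs orbT.
pose A u := \sum_(v <- nb u) f v.
pose y u : R := if u \in s then A u else 0.
pose g v : R := if v \in t then f v else 0.
have YE : \sum_(u <- S) y u ^+ 2 = Y.
  rewrite /Y -(sum_subset_uniq _ _ _ _ _ us uS sS) [RHS]big_mkcond; apply: eq_bigr => u _.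
  by rewrite /y; case: ifP => // _; rewrite expr0n.
have XE : \sum_(u <- S) g u ^+ 2 = X.
  rewrite /X -(sum_subset_uniq _ _ _ _ _ ut uS tS) [RHS]big_mkcond; apply: eq_bigr => u _.
  by rewrite /g; case: ifP => // _; rewrite expr0n.
have ByE : \sum_(u <- S) \sum_(v <- S | `[< hadj G u v >]) y u * g v = Y.
  rewrite -YE; apply: eq_bigr => u _; rewrite -big_distrr /= expr2 /y.
  case: ifP => us'; last by rewrite !mul0r.
  congr (_ * _); have nt : {subset nb u <= t}.
    by move=> v vu; rewrite mem_undup; apply/flattenP; exists (nb u) => //; exact: map_f.
  rewrite /A -(sum_subset_uniq _ _ _ _ _ (nb_uniq u) uS); last by move=> v /nt/tS.
  rewrite [RHS]big_mkcond [LHS]big_mkcond; apply: eq_bigr => v _.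
  case: asboolP => [/nbP vu|nuv]; first by rewrite vu /g nt.
  by case: ifP => // /nbP.
have BgE : \sum_(u <- S) \sum_(v <- S | `[< hadj G u v >]) g u * y v = Y.
  rewrite -[RHS]ByE (exchange_big_dep xpredT) //=; apply: eq_bigr => u _.
  apply: eq_big => [v|v _]; last by rewrite mulrC.
  by apply/asboolP/asboolP; exact: hadj_sym.
(* The scaling by [c] balances the terms: the outcome is [4 Y / c <= 2 c X + 2 Y / c]. *)
pose h1 u := g u + y u / c; pose h2 u := `|g u - y u / c|.
have h12 : \sum_(u <- S) h1 u ^+ 2 + \sum_(u <- S) h2 u ^+ 2 =
    2 * X + 2 * (Y / c ^+ 2).
  rewrite -XE -YE !mulr_sumr mulr_suml mulr_sumr -!big_split /=; apply: eq_bigr => u _.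
  by rewrite /h1 /h2 real_normK ?num_real//; field; rewrite gt_eqF.
have : \sum_(u <- S) \sum_(v <- S | `[< hadj G u v >]) (2 / c) * (y u * g v + g u * y v)
   <= \sum_(u <- S) \sum_(v <- S | `[< hadj G u v >]) h1 u * h1 v +
      \sum_(u <- S) \sum_(v <- S | `[< hadj G u v >]) h2 u * h2 v.
  rewrite -big_split /=; apply: ler_sum => u _; rewrite -big_split /=.
  apply: ler_sum => v _; rewrite /h1 /h2 -normrM.
  have := ler_norm (- ((g u - y u / c) * (g v - y v / c))); rewrite normrN => hn.
  rewrite -subr_ge0; apply: le_trans (_ : `|(g u - y u / c) * (g v - y v / c)| +
     (g u - y u / c) * (g v - y v / c) <= _).
    by rewrite -[X in _ + X]opprK subr_ge0.
  rewrite le_eqVlt; apply/orP; left; apply/eqP; field; exact/lt0r_neq0.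
under eq_bigr do rewrite -mulr_sumr big_split /=.
rewrite -mulr_sumr big_split /= ByE BgE => le1.
have le2 := lerD (cG S h1 uS) (cG S h2 uS).
have := le_trans le1 le2; rewrite -mulrDr h12.
have -> : 2 / c * (Y + Y) = 4 * (Y / c) by field; rewrite gt_eqF.
have -> : c * (2 * X + 2 * (Y / c ^+ 2)) = 2 * (c * X) + 2 * (Y / c).
  by field; rewrite gt_eqF.
move=> le3; have : Y / c <= c * X by lra.
by rewrite ler_pdivrMr// [c * X * c]mulrC mulrA.
Qed.

Definition sqsum_le (x : VG -> R[i]) (C : R) : Prop :=
  forall s, uniq s -> \sum_(u <- s) nsq (x u) <= C.

Lemma sqnorm_le (x : VG -> R[i]) (C : R) :
  (ell2_sqnorm x <= C%:E)%E <-> sqsum_le x C.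
Proof.
rewrite /ell2_sqnorm; split=> [xC s us|xC].
  rewrite -lee_fin -sumEFin; apply: le_trans xC; apply: esum_ge.
  exists [set` s]; first by split => //; exact: finite_seq.
  rewrite -fsbig_seq//; apply: lee_sum => u _.
  by rewrite nsq_normc.
apply: ge_ereal_sup => _ [X [finX _] <-]; rewrite fsbig_finite// sumEFin lee_fin.
by under eq_bigr do rewrite nsq_normc; apply: xC; exact: finmap.fset_uniq.
Qed.

Lemma sqsum_le_ge0 x C : sqsum_le x C -> 0 <= C.
Proof. by move/(_ [::] isT); rewrite big_nil. Qed.

Lemma sqsum_le_trans x C D : C <= D -> sqsum_le x C -> sqsum_le x D.
Proof. by move=> CD xC s us; rewrite (le_trans (xC s us)). Qed.

Lemma ell2P (x : VG -> R[i]) : ell2 x <-> exists C, sqsum_le x C.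
Proof.
split=> [xlt|[C /sqnorm_le xC]]; last by rewrite /ell2 /= (le_lt_trans xC) ?ltry.
exists (fine (ell2_sqnorm x)); apply/sqnorm_le; rewrite fineK//.
by rewrite ge0_fin_numE// esum_ge0// => u _; rewrite lee_fin sqr_ge0.
Qed.

Lemma ell2_sqnormE (x : VG -> R[i]) : ell2 x -> exists K, [/\ ell2_sqnorm x = K%:E,
  sqsum_le x K & forall C, sqsum_le x C -> K <= C].
Proof.
move=> xl; exists (fine (ell2_sqnorm x)).
have xE : (fine (ell2_sqnorm x))%:E = ell2_sqnorm x.
  by rewrite fineK// ge0_fin_numE// esum_ge0// => u _; rewrite lee_fin sqr_ge0.
by split => // [|C /sqnorm_le]; [apply/sqnorm_le|]; rewrite -?lee_fin xE.
Qed.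

Lemma sqsum_leZ z x C : sqsum_le x C -> sqsum_le (fun u => z * x u) (nsq z * C).
Proof.
move=> xC s us; under eq_bigr do rewrite nsqM.
by rewrite -mulr_sumr ler_wpM2l ?nsq_ge0 ?xC.
Qed.

Lemma sqsum_leB x y C D : sqsum_le x C -> sqsum_le y D ->
  sqsum_le (fun u => x u - y u) (2 * C + 2 * D).
Proof.
move=> xC yD s us.
apply: le_trans (_ : \sum_(u <- s) (2 * nsq (x u) + 2 * nsq (y u)) <= _).
  by apply: ler_sum => u _; have := nsqB_le 1 (x u) (y u) ltr01; rewrite invr1.
by rewrite big_split /= -!mulr_sumr lerD// ler_wpM2l ?xC ?yD.
Qed.

Lemma adj_opB (x y : VG -> R[i]) u :
  adj_op (fun v => x v - y v) u = adj_op x u - adj_op y u.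
Proof. by rewrite !adj_opE sumrB. Qed.

Lemma adj_opZ z (x : VG -> R[i]) u : adj_op (fun v => z * x v) u = z * adj_op x u.
Proof. by rewrite !adj_opE mulr_sumr. Qed.

Section Bounded.
Variable c : R.
Hypothesis c0 : 0 < c.
Hypothesis cG : form_bound R G c.

(** The operator has real coefficients, so real and imaginary parts are estimated separately. *)
Lemma sqsum_adj_op x C : sqsum_le x C -> sqsum_le (adj_op x) (c ^+ 2 * C).
Proof.
move=> xC s us.
have -> : \sum_(u <- s) nsq (adj_op x u) =
    \sum_(u <- s) (\sum_(v <- nb u) complex.Re (x v)) ^+ 2 +
    \sum_(u <- s) (\sum_(v <- nb u) complex.Im (x v)) ^+ 2.
  rewrite -big_split /=; apply: eq_bigr => u _.
  by rewrite adj_opE /nsq Re_sum Im_sum.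
have := lerD (adjacency_sum_sqr_le c (fun v => complex.Re (x v)) s c0 cG us)
             (adjacency_sum_sqr_le c (fun v => complex.Im (x v)) s c0 cG us).
move/le_trans; apply; rewrite -mulrDr -big_split /= ler_wpM2l ?sqr_ge0//.
by apply: xC; exact: undup_uniq.
Qed.

Variable z : R[i].
Hypothesis cz : c ^+ 2 < nsq z.

(** A priori estimate from [z x = A x - (A - z) x]: the squared norm [K] of [x] satisfies
    [|z|^2 K <= (1 + e) c^2 K + (1 + 1 / e) B], and the first term is absorbed on the left. *)
Lemma sqsum_resolvent : exists2 k : R, 0 <= k & forall x B, ell2 x ->
  sqsum_le (adj_shift z x) B -> sqsum_le x (k * B).
Proof.
have c20 : 0 < c ^+ 2 by rewrite exprn_gt0.
(* This [e] puts [(1 + e) * c ^+ 2] halfway between [c ^+ 2] and [nsq z]. *)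
pose e := (nsq z - c ^+ 2) / (2 * c ^+ 2).
have e0 : 0 < e by rewrite divr_gt0 ?mulr_gt0 ?subr_gt0.
have ec : (1 + e) * c ^+ 2 = (nsq z + c ^+ 2) / 2 by rewrite /e; field; rewrite gt_eqF.
pose k := (1 + e^-1) / ((nsq z - c ^+ 2) / 2).
have k0 : 0 <= k.
  by rewrite divr_ge0 ?addr_ge0 ?invr_ge0 ?ltW// divr_gt0// subr_gt0.
exists k => // x B /ell2_sqnormE[K [_ xK Kmin]] xB.
suff: K <= k * B by move/sqsum_le_trans; apply.
have B0 := sqsum_le_ge0 _ _ xB.
suff xK' : sqsum_le x ((((nsq z + c ^+ 2) / 2) * K + (1 + e^-1) * B) / nsq z).
  have := Kmin _ xK'; rewrite ler_pdivlMr ?(lt_trans c20)// => le1.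
  rewrite /k mulrAC ler_pdivlMr ?divr_gt0 ?subr_gt0//.
  by move: le1; set D := (1 + e^-1) * B; lra.
move=> s us; rewrite ler_pdivlMr ?(lt_trans c20)// mulrC mulr_sumr.
apply: le_trans (_ : \sum_(u <- s) ((1 + e) * nsq (adj_op x u) +
    (1 + e^-1) * nsq (adj_shift z x u)) <= _).
  apply: ler_sum => u _; rewrite -nsqM; apply: le_trans (nsqB_le _ _ _ e0).
  by rewrite /adj_shift opprB addrC subrK.
rewrite big_split /= -!mulr_sumr lerD//.
  rewrite -ec -mulrA; apply: ler_wpM2l; first by rewrite addr_ge0 ?ltW.
  exact: (sqsum_adj_op _ _ xK).
by apply: ler_wpM2l (xB _ us); rewrite addr_ge0 ?invr_ge0 ?ltW.
Qed.

(** Neumann series: [x] is the pointwise sum of [- A^n y / z^(n+1)], dominated by a geometric series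
    of ratio [c / |z|]. *)
Lemma adj_shift_surj (y : VG -> R[i]) : ell2 y ->
  exists2 x : VG -> R[i], ell2 x & adj_shift z x = y.
Proof.
move=> /ell2P[C yC].
have C0 := sqsum_le_ge0 _ _ yC.
have [k k0 kP] := sqsum_resolvent.
have zsq0 : 0 < nsq z by rewrite (lt_trans _ cz)// exprn_gt0.
have z0 : z != 0 by apply/eqP => z0; rewrite z0 nsq0 ltxx in zsq0.
pose a n := iter n (@adj_op R G) y.
have aC n : sqsum_le (a n) ((c ^+ 2) ^+ n * C).
  elim: n => [|n IHn]; first by rewrite expr0 mul1r.
  by rewrite exprS -mulrA; exact: (sqsum_adj_op _ _ IHn).
pose q := c / Num.sqrt (nsq z).
have zi0 : 0 <= (nsq z)^-1 by rewrite invr_ge0 ltW.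
have sz0 : 0 < Num.sqrt (nsq z) by rewrite sqrtr_gt0.
have q01 : 0 <= q < 1.
  rewrite divr_ge0 ?ltW//= ltr_pdivrMr// mul1r.
  by rewrite -[ltLHS]ger0_norm ?ltW// -sqrtr_sqr ltr_sqrt.
have qsq : q ^+ 2 = c ^+ 2 / nsq z by rewrite expr_div_n sqr_sqrtr ?ltW.
have aq u n : nsq ((z ^+ n)^-1 * a n u) <= (Num.sqrt C * q ^+ n) ^+ 2.
  have := aC n [:: u] isT; rewrite big_seq1 => le1.
  rewrite nsqM nsqV nsqX exprMn sqr_sqrtr// -exprM mulnC exprM qsq expr_div_n.
  by rewrite mulrC mulrA [C * _]mulrC ler_wpM2r// invr_ge0 exprn_ge0// ltW.
pose b u n := - z^-1 * ((z ^+ n)^-1 * a n u).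
pose xn n u := \sum_(i < n) b u i.
have /choice[x xP] : forall u, exists l, cvgc (fun n => xn n u) l.
  move=> u; apply: (cvgc_series _ (Num.sqrt (nsq z)^-1 * Num.sqrt C) q) => // n.
  rewrite /b nsqM nsqN nsqV -mulrA exprMn sqr_sqrtr//.
  by rewrite ler_wpM2l// aq.
have xnS n : xn n.+1 = fun u => xn n u - (z^-1 * (z ^+ n)^-1) * a n u.
  by apply/funext => u; rewrite /xn big_ord_recr /= /b mulNr mulrA.
have xn0 : xn 0 = fun=> 0 by apply/funext => u; rewrite /xn big_ord0.
have xnA n u : adj_shift z (xn n) u = y u - (z ^+ n)^-1 * a n u.
  elim: n u => [|n IHn] u.
    rewrite xn0 /adj_shift adj_opE big1// mulr0 subrr expr0 invr1 mul1r.
    by rewrite /a /= subrr.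
  have := IHn u; rewrite xnS /adj_shift adj_opB adj_opZ => e.
  set w := z^-1 / z ^+ n.
  have zw : z * w = (z ^+ n)^-1 by rewrite /w mulrA divff// mul1r.
  have -> : adj_op (xn n) u - w * adj_op (a n) u - z * (xn n u - w * a n u) =
    (adj_op (xn n) u - z * xn n u) - w * adj_op (a n) u + (z * w) * a n u by ring.
  by rewrite e zw exprS invfM -/w /a /=; ring.
have xnl n : ell2 (xn n).
  apply/ell2P; elim: n => [|n [K IHn]].
    by exists 0 => s _; rewrite xn0 big1// => i _; rewrite nsq0.
  by rewrite xnS; eexists; apply: sqsum_leB IHn (sqsum_leZ _ _ _ (aC n)).
(* The a priori estimate bounds the partial sums in l^2 uniformly in [n], since [A - z] maps them to
   [y - A^n y / z^n]. *)
have xnB n : sqsum_le (xn n) (k * (2 * C + 2 * C)).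
  apply: kP => //; rewrite (_ : adj_shift z (xn n) =
    fun u => y u - (z ^+ n)^-1 * a n u); last exact/funext.
  apply: sqsum_leB => //; apply: sqsum_le_trans (sqsum_leZ _ _ _ (aC n)).
  rewrite mulrA nsqV nsqX ler_piMl// mulrC -expr_div_n exprn_ile1//.
    by rewrite divr_ge0 ?sqr_ge0 ?ltW.
  by rewrite ler_pdivrMr// mul1r ltW.
exists x.
  (* On finite sums the uniform bound passes to the pointwise limit. *)
  apply/ell2P; exists (k * (2 * C + 2 * C)) => s us.
  have cv : \sum_(u <- s) nsq (xn n u) @[n --> \oo] --> \sum_(u <- s) nsq (x u).
    apply: cvg_big => [|u _]; first exact: add_continuous.
    by rewrite /nsq; apply: cvgD; rewrite expr2; under eq_fun do rewrite expr2;
       apply: cvgM; case: (xP u).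
  rewrite -(cvg_lim _ cv)//; apply: limr_le; first by apply/cvg_ex; eexists; exact: cv.
  by near=> n; exact: xnB.
(* At each vertex [A] is a finite sum, hence continuous for pointwise convergence. *)
apply/funext => u; apply: (cvgc_unique (fun n => adj_shift z (xn n) u)).
  rewrite /adj_shift; apply: cvgcB; last exact/cvgcZ.
  by rewrite adj_opE; under eq_fun do rewrite adj_opE; exact: cvgc_sum.
under eq_fun do rewrite xnA.
rewrite -[X in cvgc _ X]subr0; apply: cvgcB.
  by split; exact: cvg_cst.
by apply: (cvgc_geometric0 _ (Num.sqrt C) q).
Unshelve. all: by end_near.
Qed.

Lemma adj_shift_resolvent : resolvent_set G z.
Proof.
have [k k0 kP] := sqsum_resolvent.
have shl (x : VG -> R[i]) : ell2 x -> ell2 (adj_shift z x).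
  move=> /ell2P[C xC]; apply/ell2P; eexists; apply: sqsum_leB; first exact: sqsum_adj_op xC.
  exact: sqsum_leZ xC.
split; last first.
  exists k => x xl; have [B [-> xB _]] := ell2_sqnormE _ (shl _ xl).
  by rewrite -EFinM; apply/sqnorm_le; exact: kP.
split => [x||y /adj_shift_surj[x]]; [exact: shl| |by exists x].
move=> x y; rewrite !inE => xl yl xy.
have /ell2P[C xC] := xl; have /ell2P[D yD] := yl.
(* The difference of two preimages has image 0, so the estimate with bound 0 kills it. *)
have : sqsum_le (fun u => x u - y u) (k * 0).
  apply: kP; first by apply/ell2P; eexists; exact: sqsum_leB xC yD.
  move=> s _; rewrite big1// => u _.
  have := congr1 (fun f => f u) xy; rewrite /adj_shift adj_opB => e.
  have -> : adj_op x u - adj_op y u - z * (x u - y u) =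
    (adj_op x u - z * x u) - (adj_op y u - z * y u) by ring.
  by rewrite e subrr nsq0.
move=> xy0; apply/funext => u; apply/eqP; rewrite -subr_eq0; apply/eqP/nsq_eq0.
apply/eqP; rewrite eq_le nsq_ge0 andbT.
by have := xy0 [:: u] isT; rewrite big_seq1 mulr0.
Qed.

End Bounded.

Lemma spectral_radius_le (c : R) : 0 <= c -> form_bound R G c ->
  (spectral_radius R G <= c%:E)%E.
Proof.
move=> c0 cG; apply: ge_ereal_sup => _ [z zG <-]; rewrite lee_fin leNgt.
apply/negP => cz; apply: zG.
(* Strictly between [c] and [|z|], hence positive even when [c = 0]. *)
pose c' := (c + Normc.normc z) / 2.
have c'c : c < c' by rewrite /c'; lra.
have c'0 : 0 < c' by rewrite (le_lt_trans c0).
have cG' : form_bound R G c'.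
  move=> s f us; apply: le_trans (cG s f us) _.
  apply: ler_wpM2r; last exact: ltW.
  by rewrite sumr_ge0// => u _; rewrite sqr_ge0.
apply: (adj_shift_resolvent c') => //.
have c'z : c' < Normc.normc z by rewrite /c'; lra.
by rewrite -nsq_normc ltr_pXn2r ?nnegrE ?ltW// (lt_trans c'0).
Qed.

End Resolvent.

(** * Second eigenvalue of a symmetric matrix *)

Lemma nth1_sorted_ge (R : realDomainType) (c : R) (s : seq R) :
  sorted (fun x y => y <= x) s -> (1 < count (fun x => (c <= x)%R) s)%N ->
  c <= nth 0 s 1.
Proof.
case: s => [|a [|b s]] //=; first by case: (c <= a).
case/andP=> ab bs; case: (lerP c b) => // bc.
have /allP bmin : all (fun x => x <= b) s.
  by apply: order_path_min bs => y x z xy yz; exact: le_trans yz xy.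
have /eqP-> : count (fun x => c <= x) s == 0%N.
  by rewrite -leqn0 leqNgt -has_count; apply/hasPn => x /bmin xb; rewrite -ltNge (le_lt_trans xb).
by rewrite add0n addn0; case: (c <= a).
Qed.

Lemma char_poly_conj (F : fieldType) (n : nat) (P D : 'M[F]_n) : P \in unitmx ->
  char_poly (invmx P *m D *m P) = char_poly D.
Proof.
move=> Pu; rewrite /char_poly /char_poly_mx.
pose Q := map_mx polyC P; pose Q' := map_mx polyC (invmx P).
have QQ : Q' *m Q = 1%:M by rewrite -map_mxM mulVmx// map_mx1.
rewrite !map_mxM -/Q -/Q'.
have -> : 'X%:M - Q' *m map_mx polyC D *m Q = Q' *m ('X%:M - map_mx polyC D) *m Q.
  rewrite mulmxBr mulmxBl; congr (_ - _).
  by rewrite scalar_mxC -mulmxA QQ mulmx1.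
by rewrite !det_mulmx mulrAC -det_mulmx QQ det1 mul1r.
Qed.

Section RealSymmetric.
Context {R : realType} {n : nat}.
Variable A : 'M[R]_n.
Hypothesis Asym : A^T = A.
Local Notation rc := (real_complex R).
(** The spectral theorem is applied to the complexification [AC = P^* D P], with [P] unitary and [D]
    real. *)
Let AC : 'M[R[i]]_n := map_mx rc A.
Let P := spectralmx AC.
Let D := spectral_diag AC.

Lemma rc_real (m p : nat) (B : 'M[R]_(m, p)) : map_mx rc B \is a mxOver Num.real.
Proof. by apply/mxOverP => i j; rewrite mxE complex_real. Qed.

Lemma AC_hermsym : AC \is hermsymmx.
Proof.
apply: realsym_hermsym (rc_real _ _ _); apply/is_hermitianmxP.
by rewrite expr0 scale1r map_mx_id// /AC map_trmx Asym.
Qed.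

Definition real_eigenvalue (j : 'I_n) : R := complex.Re (D 0 j).

Lemma real_eigenvalueE j : D 0 j = rc (real_eigenvalue j).
Proof.
have /mxOverP/(_ 0 j) := hermitian_spectral_diag_real AC_hermsym.
by rewrite -/D => /RRe_real <-.
Qed.

Lemma AC_spectral : AC = invmx P *m diag_mx D *m P.
Proof. exact/orthomx_spectralP/hermitian_normalmx/AC_hermsym. Qed.

Lemma char_poly_real_eigenvalue :
  char_poly A = \prod_(x <- [seq real_eigenvalue j | j <- enum 'I_n]) ('X - x%:P).
Proof.
apply: (map_poly_inj rc); rewrite map_char_poly -/AC AC_spectral.
rewrite char_poly_conj ?spectral_unit// char_poly_trig ?diag_mx_is_trig//.
rewrite big_map rmorph_prod /= big_enum /=; apply: eq_bigr => j _.
by rewrite rmorphB /= map_polyX map_polyC /= mxE eqxx mulr1n -real_eigenvalueE.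
Qed.

(** [real_eigenvalue] provides a list of roots, so the one picked by [xget] is a genuine
    factorization, and such factorizations are unique up to order. *)
Lemma eigenvalues_perm :
  perm_eq (eigenvalues A) [seq real_eigenvalue j | j <- enum 'I_n].
Proof.
rewrite /eigenvalues perm_sort; apply: prod_XsubC_eq.
rewrite -char_poly_real_eigenvalue.
have := @xgetI _ [::] [set s | char_poly A = \prod_(x <- s) ('X - x%:P)] _
  char_poly_real_eigenvalue.
by move=> /= <-.
Qed.

(** Courant-Fischer on the plane spanned by [x] and [y]. If at most one eigenvalue reached [c], some
    nontrivial complex combination [V] would be orthogonal to its eigenvector; there the form of
    [A - c] is both nonnegative and a sum of nonpositive terms, which forces [V = 0]. *)
Lemma second_eigenvalue_ge (c : R) (x y : 'rV[R]_n) :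
  (forall a b, a *: x + b *: y = 0 -> a = 0 /\ b = 0) ->
  (forall a b, let v := a *: x + b *: y in
     c * (v *m v^T) 0 0 <= (v *m A *m v^T) 0 0) ->
  c <= nth 0 (eigenvalues A) 1.
Proof.
move=> xy xyc; apply: nth1_sorted_ge.
  by apply: sort_sorted => a b; exact: le_total.
rewrite (permP eigenvalues_perm) count_map.
have -> p : count p (enum 'I_n) = #|[pred j | p j]|.
  by rewrite enumT -size_filter cardE.
rewrite ltnNge; apply/negP => /card_le1_eqP one.
(* If no eigenvalue reaches [c], any index serves as [i0]; one exists because [x] is nonzero. *)
have [i0 i0P] : exists i0, forall j, j != i0 -> real_eigenvalue j < c.
  have [[i ic]|nex] := pselect (exists i, c <= real_eigenvalue i).
    exists i => j; apply: contraNT; rewrite -leNgt => jc.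
    by apply/eqP/one.
  have /eqP/rowP/existsNP[j _] : x != 0.
    apply/eqP => x0; have [] := xy 1 0; first by rewrite x0 scaler0 scale0r addr0.
    by move/eqP; rewrite oner_eq0.
  by exists j => k _; rewrite ltNge; apply/negP => kc; apply: nex; exists k.
pose X := map_mx rc x *m (P^t*)%sesqui; pose Y := map_mx rc y *m (P^t*)%sesqui.
(* A nontrivial solution of one linear equation in two unknowns. *)
have [a [b [ab0 ab]]] : exists a b : R[i],
    a * X 0 i0 + b * Y 0 i0 = 0 /\ ((a != 0) || (b != 0)).
  have [X0|X0] := eqVneq (X 0 i0) 0.
    by exists 1, 0; rewrite X0 mulr0 mul0r addr0 oner_eq0.
  exists (- Y 0 i0), (X 0 i0); rewrite X0 orbT; split => //.
  by rewrite mulNr mulrC addrC subrr.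
pose V := a *: map_mx rc x + b *: map_mx rc y.
pose W := V *m (P^t*)%sesqui.
have W0 : W 0 i0 = 0.
  by rewrite /W /V mulmxDl -!scalemxAl -/X -/Y !mxE; move: ab0; rewrite !mxE.
have PP : (P^t*)%sesqui *m P = 1%:M.
  by rewrite -invmx_unitary ?spectral_unitarymx// mulVmx ?spectral_unit.
have WP : W *m P = V by rewrite /W -mulmxA PP mulmx1.
have PW : P *m (V^t*)%sesqui = (W^t*)%sesqui.
  by rewrite /W trmx_mul map_mxM trmxCK.
have VW : (V *m (V^t*)%sesqui) 0 0 = \sum_j `|W 0 j| ^+ 2.
  rewrite -{1}WP -mulmxA PW mxE; apply: eq_bigr => j _.
  by rewrite !mxE -normCK.
have VAW : (V *m AC *m (V^t*)%sesqui) 0 0 = \sum_j D 0 j * `|W 0 j| ^+ 2.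
  rewrite AC_spectral invmx_unitary ?spectral_unitarymx// !mulmxA -/W -mulmxA PW.
  rewrite mxE; apply: eq_bigr => j _; rewrite mul_mx_diag !mxE normCK.
  by rewrite mulrAC mulrC.
(* The real and imaginary parts of [V] are real combinations of [x] and [y], so the hypotheses apply
   to each. *)
pose v1 := complex.Re a *: x + complex.Re b *: y.
pose v2 := complex.Im a *: x + complex.Im b *: y.
have VE : V = map_mx rc v1 + 'i%C *: map_mx rc v2.
  apply/rowP => j; rewrite !mxE [in LHS](complexE a) [in LHS](complexE b).
  by rewrite !rmorphD !rmorphM /=; ring.
have VtE : (V^t*)%sesqui = (map_mx rc v1)^T - 'i%C *: (map_mx rc v2)^T.
  apply/colP => j; rewrite VE !mxE rmorphD rmorphM /= !complexiE conjCi.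
  by rewrite !(CrealP _) ?complex_real// mulNr.
(* The cross terms of [v1] and [v2] cancel because [M] is symmetric. *)
have quad (M : 'M[R]_n) : M^T = M -> (V *m map_mx rc M *m (V^t*)%sesqui) 0 0 =
    rc ((v1 *m M *m v1^T) 0 0 + (v2 *m M *m v2^T) 0 0).
  move=> Msym; rewrite VtE VE !map_trmx.
  rewrite mulmxDl mulmxDl !mulmxBr -!scalemxAl -!scalemxAr -!map_mxM.
  have -> : v2 *m M *m v1^T = v1 *m M *m v2^T.
    rewrite [LHS]mx11_scalar -[LHS]tr_scalar_mx -mx11_scalar.
    by rewrite !trmx_mul trmxK Msym mulmxA.
  have := sqr_i R; set m1 := v1 *m M *m v1^T; set m2 := v1 *m M *m v2^T.
  set m3 := v2 *m M *m v2^T; clearbody m1 m2 m3; rewrite !mxE /= rmorphD => i2.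
  by ring: i2.
have ge0 : 0 <= \sum_j (D 0 j - rc c) * `|W 0 j| ^+ 2.
  under eq_bigr do rewrite mulrBl.
  rewrite sumrB -mulr_sumr -VW -VAW subr_ge0.
  have := quad A Asym; rewrite -/AC => ->.
  have := quad 1%:M (trmx1 _ _); rewrite map_mx1 !mulmx1 => ->.
  rewrite -rmorphM /= lecR mulrDr lerD//; first exact: (xyc (complex.Re a) (complex.Re b)).
  exact: (xyc (complex.Im a) (complex.Im b)).
have Wj0 j : W 0 j = 0.
  have [->//|ji0] := eqVneq j i0.
  have terms k : true -> 0 <= (rc c - D 0 k) * `|W 0 k| ^+ 2.
    move=> _; have [->|/i0P kc] := eqVneq k i0; first by rewrite W0 normr0 expr0n mulr0.
    by rewrite mulr_ge0 ?exprn_ge0// real_eigenvalueE -rmorphB /= lecR subr_ge0 ltW.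
  have sum0 : \sum_k (rc c - D 0 k) * `|W 0 k| ^+ 2 = 0.
    apply/eqP; rewrite eq_le sumr_ge0// andbT -oppr_ge0 -sumrN.
    by under eq_bigr do rewrite -mulNr opprB.
  have /eqP : (rc c - D 0 j) * `|W 0 j| ^+ 2 = 0 by exact: (psumr_eq0P terms sum0).
  rewrite mulf_eq0 real_eigenvalueE -rmorphB /= => /orP[|].
    by rewrite fmorph_eq0 subr_eq0 gt_eqF// i0P.
  by rewrite expf_eq0 normr_eq0 => /andP[_ /eqP].
have V0 : V = 0.
  by rewrite -WP (_ : W = 0) ?mul0mx//; apply/rowP => j; rewrite Wj0 mxE.
have VjE j : V 0 j = (v1 0 j +i* v2 0 j)%C.
  by rewrite VE !mxE [RHS]complexE.
have v10 : v1 = 0.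
  by apply/rowP => j; have /rowP/(_ j) := V0; rewrite VjE [in RHS]mxE => -[-> _]; rewrite mxE.
have v20 : v2 = 0.
  by apply/rowP => j; have /rowP/(_ j) := V0; rewrite VjE [in RHS]mxE => -[_ ->]; rewrite mxE.
have [a1 b1] := xy _ _ v10; have [a2 b2] := xy _ _ v20.
move: ab; rewrite (complexE a) (complexE b) a1 a2 b1 b2.
by rewrite !mulr0 addr0 eqxx.
Qed.

End RealSymmetric.

Lemma sum_enum_val (R : nmodType) (V : finType) (g : V -> R) :
  \sum_v g v = \sum_(j < #|V|) g (enum_val j).
Proof. by rewrite [LHS](reindex (@enum_val _ V)) //; exact/onW_bij/enum_val_bij. Qed.

(** * The quadratic form of a finite hypergraph *)

Section QuadraticForm.
Context {R : realType} {V E : finType}.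
Variable H : E -> {set V}.

(** The adjacency operator as a sum over incident edges, the shape to which sums on the cover
    project ([cover_sum_le]); [hadjacency_mul] matches it with the matrix. *)
Definition nbsum (F : V -> R) (u : V) : R :=
  \sum_(a | u \in H a) \sum_(v in H a | v != u) F v.

Definition qform (F : V -> R) : R := \sum_u F u * nbsum F u.

Lemma hadjacency_sym : (hadjacency H R)^T = hadjacency H R.
Proof.
apply/matrixP => i j; rewrite !mxE eq_sym; case: eqP => // _.
by congr (_%:R); apply: eq_card => e; rewrite !inE andbC.
Qed.

Lemma hadjacency_mul (F : V -> R) (i : 'I_#|V|) :
  \sum_j hadjacency H R i j * F (enum_val j) = nbsum F (enum_val i).
Proof.
rewrite /nbsum (exchange_big_dep (fun v => v != enum_val i)) /=; last first.
  by move=> a v _ /andP[].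
rewrite [RHS]big_mkcond [RHS]sum_enum_val /=; apply: eq_bigr => j _.
rewrite mxE (inj_eq enum_val_inj) [j == i]eq_sym.
case: eqVneq => /= [_|ij]; first by rewrite mul0r.
rewrite sumr_const mulr_natl; congr (_ *+ _).
apply: eq_card => e; rewrite !inE; congr (_ && _).
by rewrite andbT.
Qed.

Lemma hlambda2_ge (c : R) (F F' : V -> R) :
  (forall a b, (forall v, a * F v + b * F' v = 0) -> a = 0 /\ b = 0) ->
  (forall a b, c * \sum_v (a * F v + b * F' v) ^+ 2 <=
     qform (fun v => a * F v + b * F' v)) ->
  c <= hlambda R H 2.
Proof.
move=> ind quad; rewrite /hlambda /=.
pose x := \row_(j < #|V|) F (enum_val j); pose y := \row_(j < #|V|) F' (enum_val j).
apply: (second_eigenvalue_ge _ hadjacency_sym c x y) => a b.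
  move=> /rowP xy0; apply: ind => v; have := xy0 (enum_rank v).
  by rewrite !mxE enum_rankK.
pose f v := a * F v + b * F' v.
have : c * \sum_v f v ^+ 2 <= qform f by exact: quad.
rewrite /qform [X in c * X <= _]sum_enum_val [X in _ <= X]sum_enum_val => le1.
set w := _ + _; have wE j : w 0 j = f (enum_val j) by rewrite !mxE.
have -> : (w *m w^T) 0 0 = \sum_(j < #|V|) f (enum_val j) ^+ 2.
  by rewrite mxE; apply: eq_bigr => j _; rewrite [w^T j 0]mxE !wE expr2.
have -> // : (w *m hadjacency H R *m w^T) 0 0 =
  \sum_(j < #|V|) f (enum_val j) * nbsum f (enum_val j).
rewrite mxE; apply: eq_bigr => j _; rewrite [w^T j 0]mxE wE mulrC; congr (_ * _).
rewrite mxE -hadjacency_mul; apply: eq_bigr => k _.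
by rewrite wE mulrC; congr (_ * _); rewrite -[in RHS]hadjacency_sym [RHS]mxE.
Qed.

(** Disjoint supports with no edge between them make the squared norm and the form additive on the
    span of [F] and [F'], so the two bounds extend to the whole plane. *)
Lemma hlambda2_ge_far (c : R) (F F' : V -> R) :
  (exists v, F v != 0) -> (exists v, F' v != 0) ->
  (forall v, F v * F' v = 0) ->
  (forall e u v, u \in H e -> v \in H e -> F u * F' v = 0) ->
  c * \sum_v F v ^+ 2 <= qform F -> c * \sum_v F' v ^+ 2 <= qform F' ->
  c <= hlambda R H 2.
Proof.
move=> [u Fu] [u' Fu'] FF' far qF qF'; apply: (hlambda2_ge c F F') => a b.
  move=> ab0; split; apply/eqP.
    have /eqP := FF' u; rewrite mulf_eq0 (negbTE Fu) /= => /eqP F'u.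
    by have /eqP := ab0 u; rewrite F'u mulr0 addr0 mulf_eq0 (negbTE Fu) orbF.
  have /eqP := FF' u'; rewrite mulf_eq0 (negbTE Fu') orbF => /eqP F'u.
  by have /eqP := ab0 u'; rewrite F'u mulr0 add0r mulf_eq0 (negbTE Fu') orbF.
pose f v := a * F v + b * F' v; rewrite -[leRHS]/(qform f) -[leLHS]/(c * \sum_v f v ^+ 2).
have -> : \sum_v f v ^+ 2 = a ^+ 2 * \sum_v F v ^+ 2 + b ^+ 2 * \sum_v F' v ^+ 2.
  rewrite !mulr_sumr -big_split /=; apply: eq_bigr => v _.
  by have := FF' v; rewrite /f => e; ring: e.
have -> : qform f = a ^+ 2 * qform F + b ^+ 2 * qform F'.
  rewrite /qform !mulr_sumr -big_split /=; apply: eq_bigr => v _.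
  rewrite /nbsum !mulr_sumr -big_split /=; apply: eq_bigr => e ve.
  rewrite !mulr_sumr -big_split /=; apply: eq_bigr => w /andP[we _].
  by have := far _ _ _ ve we; have := far _ _ _ we ve; rewrite /f => e1 e2; ring: e1 e2.
rewrite mulrDr !(mulrCA c) lerD// ler_wpM2l ?sqr_ge0//.
Qed.

(** A crude bound that makes the errors for a given number of vertices bounded above. It sums
    [- f v f w <= (f v ^ 2 + f w ^ 2) / 2] over the [d] edges at each [v] and over all [w], for [f]
    in the span of two indicators. *)
Lemma hlambda2_lower_bound (d : nat) : hregular H d -> (2 <= #|V|)%N ->
  - (d * #|V|)%:R <= hlambda R H 2.
Proof.
move=> Hd /card_gt1P[u [u' [_ _ uu']]].
apply: (hlambda2_ge _ (fun v => (v == u)%:R) (fun v => (v == u')%:R)) => a b.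
  move=> ab0; split.
    by have := ab0 u; rewrite eqxx (negbTE uu') mulr1 mulr0 addr0.
  by have := ab0 u'; rewrite eqxx eq_sym (negbTE uu') mulr1 mulr0 add0r.
pose f v : R := a * (v == u)%:R + b * (v == u')%:R.
rewrite -[leRHS]/(qform f) -[leLHS]/(- (d * #|V|)%:R * \sum_v f v ^+ 2) mulNr lerNl /qform -sumrN.
set S := \sum_v f v ^+ 2.
apply: le_trans (_ : \sum_v \sum_(e | v \in H e) \sum_w (f v ^+ 2 + f w ^+ 2) / 2 <= _).
  apply: ler_sum => v _; rewrite /nbsum -mulNr mulr_sumr; apply: ler_sum => e _.
  rewrite mulr_sumr [leRHS](bigID (fun w => (w \in H e) && (w != v))) /=.
  rewrite -[leLHS]addr0 lerD//.
    apply: ler_sum => w _; have := sqr_ge0 (f v + f w).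
    by rewrite sqrrD; lra.
  by apply: sumr_ge0 => w _; rewrite divr_ge0 ?addr_ge0 ?sqr_ge0.
have inner v : \sum_(e | v \in H e) \sum_w (f v ^+ 2 + f w ^+ 2) / 2 =
    d%:R * ((#|V|%:R * f v ^+ 2 + S) / 2).
  rewrite sumr_const -mulr_suml big_split /= sumr_const -/S.
  have -> : #|[pred e | v \in H e]| = d.
    by rewrite -(Hd v); apply: eq_card => e; rewrite !inE.
  by rewrite !mulr_natl.
under eq_bigr do rewrite inner.
rewrite -mulr_sumr -mulr_suml big_split /= -mulr_sumr -/S sumr_const natrM.
rewrite -[S *+ _]mulr_natl cardT -cardE.
by rewrite le_eqVlt; apply/orP; left; apply/eqP; field.
Qed.

End QuadraticForm.

(** * Pushing functions from the cover to the base *)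

Section CoverForm.
Context {R : realType} {V E : finType}.
Variables (H : E -> {set V}) (v0 : V).
Let C := universal_cover H v0.

(* AM-GM with weights: [2 f u f v <= f u ^ 2 g v / g u + f v ^ 2 g u / g v]. *)
Lemma weighted_form_le (G : hypergraph) (s : seq (hvert G)) (f g : hvert G -> R) :
  (forall u, 0 <= g u) -> (forall u, u \in s -> f u != 0 -> 0 < g u) ->
  \sum_(u <- s) \sum_(v <- s | `[< hadj G u v >]) f u * f v <=
  \sum_(u <- s) f u ^+ 2 / g u * \sum_(v <- s | `[< hadj G u v >]) g v.
Proof.
move=> g0 fg.
have -> : \sum_(u <- s) f u ^+ 2 / g u * \sum_(v <- s | `[< hadj G u v >]) g v =
  \sum_(u <- s) \sum_(v <- s | `[< hadj G u v >])
     (f u ^+ 2 / g u * g v + f v ^+ 2 / g v * g u) / 2.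
  under [RHS]eq_bigr do rewrite -mulr_suml big_split /=.
  rewrite -mulr_suml big_split /=.
  set X := LHS; rewrite [X in (_ + X) / 2](_ : _ = X); last first.
    rewrite /X (exchange_big_dep xpredT) //=; apply: eq_bigr => u _.
    rewrite mulr_sumr; apply: eq_bigl => v.
    by apply/asboolP/asboolP; exact: hadj_sym.
  rewrite [X in (X + _) / 2](_ : _ = X); last first.
    by apply: eq_bigr => u _; rewrite mulr_sumr.
  by field.
rewrite [leLHS]big_seq [leRHS]big_seq; apply: ler_sum => u us.
rewrite [leLHS]big_seq_cond [leRHS]big_seq_cond; apply: ler_sum => v /andP[vs _].
have ge0 : 0 <= (f u ^+ 2 / g u * g v + f v ^+ 2 / g v * g u) / 2.
  by rewrite divr_ge0// addr_ge0// mulr_ge0// divr_ge0// sqr_ge0.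
(* Where [f] vanishes [g] may vanish too; the left term is then 0 and the right one stays
   nonnegative, as division by 0 gives 0. *)
have [fu|fu] := eqVneq (f u) 0; first by rewrite [X in X * _]fu mul0r.
have [fv|fv] := eqVneq (f v) 0; first by rewrite [X in _ * X <= _]fv mulr0.
have gu := fg _ us fu; have gv := fg _ vs fv.
rewrite -subr_ge0.
have -> : (f u ^+ 2 / g u * g v + f v ^+ 2 / g v * g u) / 2 - f u * f v =
   (f u * g v - f v * g u) ^+ 2 / (2 * g u * g v).
  by field; rewrite !gt_eqF.
by rewrite divr_ge0 ?sqr_ge0// !mulr_ge0.
Qed.

Lemma cover_degree u (s : seq (hvert C)) : uniq s ->
  (count (fun v => `[< hadj C u v >]) s <= #|E| * #|V|)%N.
Proof.
move=> us; rewrite -(ler_nat rat).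
have := cover_sum_le H v0 rat (fun=> 1) u s us (fun=> ler01).
rewrite -[\sum_(v <- s | _) 1]/(\sum_(v <- s | _) 1%:R) -natr_sum sum1_count.
move/le_trans; apply.
apply: le_trans (_ : \sum_(a : E) \sum_(v : V) (1 : rat) <= _); last first.
  by rewrite !sumr_const -mulrnA mulnC !cardT -!cardE.
rewrite [leRHS](bigID (fun a => vend H v0 u \in H a)) /= -[leLHS]addr0 lerD//.
  apply: ler_sum => a _.
  rewrite [leRHS](bigID (fun v => (v \in H a) && (v != vend H v0 u))) /=.
  by rewrite -[leLHS]addr0 lerD// sumr_ge0.
by rewrite sumr_ge0// => a _; rewrite sumr_ge0.
Qed.

(** AM-GM with equal weights bounds the form by the degree; hence form bounds exist. *)
Lemma cover_form_bound : form_bound R C (#|E| * #|V|)%:R.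
Proof.
move=> s f us; apply: le_trans (weighted_form_le C s f (fun=> 1) _ _) _ => //.
rewrite mulr_sumr; apply: ler_sum => u _; rewrite divr1 mulrC ler_wpM2r ?sqr_ge0//.
rewrite -[\sum_(v <- s | _) 1]/(\sum_(v <- s | _) 1%:R) -natr_sum sum1_count.
by rewrite ler_nat cover_degree.
Qed.

Definition push (s : seq (hvert C)) (f : hvert C -> R) (v : V) : R :=
  Num.sqrt (\sum_(u <- s | vend H v0 u == v) f u ^+ 2).

Lemma push_sqr s f v : push s f v ^+ 2 = \sum_(u <- s | vend H v0 u == v) f u ^+ 2.
Proof. by rewrite sqr_sqrtr// sumr_ge0// => u _; rewrite sqr_ge0. Qed.

Lemma push_sqnorm s f : \sum_v push s f v ^+ 2 = \sum_(u <- s) f u ^+ 2.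
Proof.
under eq_bigr do rewrite push_sqr; rewrite (exchange_big_dep xpredT) //=.
by apply: eq_bigr => u _; rewrite (big_pred1 (vend H v0 u))// => v; rewrite eq_sym.
Qed.

Lemma push_support s f v : push s f v != 0 -> exists2 u, u \in s & vend H v0 u = v.
Proof.
move=> /eqP sv; apply: contrapT => no; apply: sv; rewrite /push big1_seq ?sqrtr0//.
by move=> u /andP[/eqP uv us]; case: no; exists u.
Qed.

(** The AM-GM weights are [F (vend u)], positive where [f u] is not 0. Neighbour sums of these
    weights are at most [nbsum H F], and summing [f ^ 2] over each fibre leaves [F ^ 2 / F = F]. *)
Lemma push_form_le s f : uniq s ->
  \sum_(u <- s) \sum_(v <- s | `[< hadj C u v >]) f u * f v <= qform H (push s f).
Proof.
move=> us; pose F := push s f; have F0 v : 0 <= F v by exact: sqrtr_ge0.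
apply: le_trans (weighted_form_le C s f (fun u => F (vend H v0 u)) _ _) _ => //.
  move=> u su fu; rewrite sqrtr_gt0 (big_rem u su) /= eqxx ltr_pwDl//.
    by rewrite exprn_even_gt0.
  by rewrite sumr_ge0// => w _; rewrite sqr_ge0.
apply: le_trans (_ : \sum_(u <- s) f u ^+ 2 / F (vend H v0 u) *
    nbsum H F (vend H v0 u) <= _).
  apply: ler_sum => u _; apply: ler_wpM2l; first by rewrite divr_ge0 ?sqr_ge0.
  exact: cover_sum_le.
rewrite /qform le_eqVlt; apply/orP; left; apply/eqP.
transitivity (\sum_v push s f v ^+ 2 / F v * nbsum H F v).
  under [RHS]eq_bigr do rewrite push_sqr -mulrA mulr_suml.
  rewrite (exchange_big_dep xpredT) //=; apply: eq_bigr => u _.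
  by rewrite (big_pred1 (vend H v0 u)) ?mulrA// => v; rewrite eq_sym.
apply: eq_bigr => v _; rewrite -/F; congr (_ * _).
have [->|Fv] := eqVneq (F v) 0; first by rewrite expr0n mul0r.
by rewrite expr2 mulfK.
Qed.

(** By local injectivity an edge at [u] is determined by its endpoint in a finite set. *)
Lemma finite_edges (u : hvert C) : finite_set [set e : hedge C | hmem e u].
Proof.
pose h (e : hedge C) := last (inl v0) (eseq H v0 e).
have hinj : set_inj [set e : hedge C | hmem e u] h.
  move=> e e'; rewrite !inE /= => /hmemE eu /hmemE eu' hh; apply: eseq_inj.
  apply: (sadj_last_inj H _ _ _ _ (eseq_nbw H v0 e) (eseq_nbw H v0 e')
    (sadj_sym _ _ eu) (sadj_sym _ _ eu')) => //.
by rewrite -(eq_finite_set (inj_card_eq hinj)); exact: finite_finset.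
Qed.

Lemma finite_members (e : hedge C) (u : hvert C) :
  finite_set [set v : hvert C | hmem e v /\ v <> u].
Proof.
pose h (v : hvert C) := last (inl v0) (vseq H v0 v).
have hinj : set_inj [set v : hvert C | hmem e v /\ v <> u] h.
  move=> v v'; rewrite !inE /= => -[/hmemE ev _] [/hmemE ev' _] hh; apply: vseq_inj.
  exact: (sadj_last_inj H _ _ _ _ (vseq_nbw H v0 v) (vseq_nbw H v0 v') ev ev').
by rewrite -(eq_finite_set (inj_card_eq hinj)); exact: finite_finset.
Qed.

Lemma flatten_map_uniq (S T : eqType) (F : S -> seq T) (es : seq S) :
  uniq es -> (forall e, uniq (F e)) ->
  (forall e e' v, e \in es -> e' \in es -> v \in F e -> v \in F e' -> e = e') ->
  uniq (flatten (map F es)).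
Proof.
move=> + uF; elim: es => [//|e es IHes] /= /andP[ees ues] inj.
rewrite cat_uniq uF IHes// ?andbT; last first.
  by move=> e1 e2 v h1 h2; apply: inj; rewrite inE ?h1 ?h2 orbT.
apply/hasPn => v /flattenP[_ /mapP[e' e'es ->] ve']; apply/negP => ve.
have ee' : e = e' by apply: (inj e e' v) => //; rewrite inE ?eqxx ?e'es ?orbT.
by rewrite ee' e'es in ees.
Qed.

(** Neighbours are enumerated edge by edge; none is listed twice, as two vertices share at most one
    edge. *)
Lemma spectral_radius_cover_le (c : R) : 0 <= c -> form_bound R C c ->
  (spectral_radius R C <= c%:E)%E.
Proof.
pose mem (u : hvert C) (e : hedge C) : seq (hvert C) :=
  finmap.enum_fset (fset_set [set v : hvert C | hmem e v /\ v <> u]).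
pose inc (u : hvert C) : seq (hedge C) :=
  finmap.enum_fset (fset_set [set e : hedge C | hmem e u]).
pose nb (u : hvert C) : seq (hvert C) := flatten (map (mem u) (inc u)).
have memP u e v : v \in mem u e <-> hmem e v /\ v <> u.
  have -> : (v \in mem u e) = (v \in [set v : hvert C | hmem e v /\ v <> u]).
    exact: (in_fset_set (finite_members e u)).
  by rewrite inE.
have incP u e : e \in inc u <-> hmem e u.
  have -> : (e \in inc u) = (e \in [set e : hedge C | hmem e u]).
    exact: (in_fset_set (finite_edges u)).
  by rewrite inE.
apply: (spectral_radius_le nb).
- move=> u; apply: flatten_map_uniq => [|e|e e' v]; try exact: finmap.fset_uniq.
  move=> /incP eu /incP eu' /memP[ev vu] /memP[ev' _].
  exact: (hmem_common H v0 v u).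
- move=> u v; split.
    case/flattenP => _ /mapP[e /incP eu ->] /memP[ev vu].
    by split; [exact/nesym|exists e].
  case=> uv [e [eu ev]]; apply/flattenP.
  exists (mem u e).
    by apply/mapP; exists e => //; exact/incP.
  by apply/memP; split => //; exact/nesym.
- move=> x u; rewrite /adj_op fsbig_finite; last exact: finite_edges.
  rewrite big_flatten big_map /=; apply: eq_bigr => e _.
  by rewrite fsbig_finite//; exact: finite_members.
Qed.

End CoverForm.

(** * Rerooting and distances *)

(** Edges are forgotten: form bounds, witnesses and distances see adjacency only. *)
Definition adj_iso (S T : hypergraph) (x : hvert S) (y : hvert T) : Prop :=
  exists f g, [/\ cancel f g, cancel g f, f x = y,
    (forall u v, hadj S u v -> hadj T (f u) (f v)) &
    (forall u v, hadj T u v -> hadj S (g u) (g v))].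

Lemma adj_iso_sym S T x y : adj_iso S T x y -> adj_iso T S y x.
Proof. by case=> f [g [fg gf <- fh gh]]; exists g, f; split. Qed.

Lemma adj_iso_trans S T U x y z :
  adj_iso S T x y -> adj_iso T U y z -> adj_iso S U x z.
Proof.
move=> [f [g [fg gf fx fh gh]]] [f' [g' [fg' gf' fx' fh' gh']]].
exists (f' \o f), (g \o g'); split.
- exact: can_comp.
- exact: can_comp.
- by rewrite /= fx.
- by move=> u v /fh/fh'.
- by move=> u v /gh'/gh.
Qed.

Lemma hiso_adj_iso S T x : hiso S T -> exists y, adj_iso S T x y.
Proof.
case=> f [h [[g fg gf] [k hk kh] fh]]; exists (f x), f, g; split => // u v [uv].
  move=> [e [eu ev]]; split; first by move/(can_inj fg).
  by exists (h e); split; apply/fh.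
move=> [e [eu ev]]; split; first by move/(can_inj gf).
by exists (k e); split; apply/fh; rewrite kh gf.
Qed.

Lemma adj_iso_form_bound (R : realType) S T x y (c : R) :
  adj_iso S T x y -> form_bound R T c -> form_bound R S c.
Proof.
move=> [f [g [fg gf _ fh gh]]] Tc s F us.
have := Tc (map f s) (F \o g); rewrite map_inj_uniq; last exact: can_inj fg.
move=> /(_ us); rewrite !big_map /=.
under eq_bigr do rewrite big_map.
congr (_ <= _ * _).
  apply: eq_bigr => u _; apply: eq_big => [v|v _]; last by rewrite !fg.
  by apply/asboolP/asboolP => [/gh|/fh//]; rewrite !fg.
by apply: eq_bigr => u _; rewrite fg.
Qed.

(** Each step may stay in place, so this is distance at most [k]. *)
Fixpoint reach (T : Type) (e : T -> T -> Prop) (k : nat) (x y : T) : Prop :=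
  if k is k'.+1 then exists z, reach T e k' x z /\ (z = y \/ e z y) else x = y.
Arguments reach {T}.

Section Reach.
Context {T : Type}.
Variable e : T -> T -> Prop.

Lemma reach_trans k l x y z :
  reach e k x y -> reach e l y z -> reach e (k + l) x z.
Proof.
move=> xy; elim: l z => [|l IHl] z /=; first by move=> <-; rewrite addn0.
by case=> w [/IHl xw wz]; rewrite addnS /=; exists w.
Qed.

Lemma reach_le k l x y : (k <= l)%N -> reach e k x y -> reach e l x y.
Proof.
move=> /subnKC <- xy; apply: reach_trans xy _.
by elim: (l - k)%N => //= m IHm; exists y; split => //; left.
Qed.

Lemma reach1 x y : e x y -> reach e 1 x y.
Proof. by exists x; split => //; right. Qed.

Lemma reach_sym (esym : forall x y, e x y -> e y x) k x y :
  reach e k x y -> reach e k y x.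
Proof.
elim: k y => [|k IHk] y; first by move=> ->.
case=> z [/IHk zx zy]; rewrite -[k.+1]add1n.
apply: reach_trans zx; exists y; split => //.
by case: zy => [->|/esym]; [left|right].
Qed.

End Reach.

Lemma reach_map (S T : Type) (e : S -> S -> Prop) (e' : T -> T -> Prop)
  (f : S -> T) k x y : (forall u v, e u v -> e' (f u) (f v)) ->
  reach e k x y -> reach e' k (f x) (f y).
Proof.
move=> ee'; elim: k y => [|k IHk] y /=; first by move=> ->.
by case=> z [/IHk xz zy]; exists (f z); split => //; case: zy => [->|/ee']; [left|right].
Qed.

(** The strict inequality forces [f] to be nonzero somewhere on [s]. *)
Definition local_witness (R : realType) (G : hypergraph) (c : R) (r : nat)
    (x : hvert G) : Prop :=
  exists (s : seq (hvert G)) (f : hvert G -> R),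
    [/\ uniq s, forall u, u \in s -> reach (hadj G) r x u &
      c * \sum_(u <- s) f u ^+ 2 <
      \sum_(u <- s) \sum_(v <- s | `[< hadj G u v >]) f u * f v].

Lemma local_witness_iso (R : realType) S T x y (c : R) r :
  adj_iso S T x y -> local_witness R S c r x -> local_witness R T c r y.
Proof.
move=> [f [g [fg gf <- fh gh]]] [s [F [us sr lt1]]].
exists (map f s), (F \o g); split.
- by rewrite map_inj_uniq//; exact: can_inj fg.
- by move=> _ /mapP[u /sr ur ->]; exact: reach_map ur.
move: lt1; rewrite !big_map /=; under [X in _ -> _ < X]eq_bigr do rewrite big_map.
congr (_ * _ < _); first by apply: eq_bigr => u _; rewrite fg.
apply: eq_bigr => u _; apply: eq_big => [v|v _]; last by rewrite !fg.
by apply/asboolP/asboolP => [/fh//|/gh]; rewrite !fg.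
Qed.

Section CoverGeometry.
Context {V E : finType}.
Variable H : E -> {set V}.

Definition edge_adj (u v : V) : Prop := exists e, u \in H e /\ v \in H e.

Lemma edge_adj_sym u v : edge_adj u v -> edge_adj v u.
Proof. by case=> e []; exists e. Qed.

Lemma cover_root v0 : exists2 x, vseq H v0 x = [::] & vend H v0 x = v0.
Proof. exact: vseq_ex. Qed.

(** Walks alternate between vertices and edges, so removing the last two letters gives a neighbour
    closer to the root. *)
Lemma cover_reach v0 x u : vseq H v0 x = [::] ->
  exists k, reach (hadj (universal_cover H v0)) k x u.
Proof.
move=> x0; have [n] := ubnP (size (vseq H v0 u)); elim: n u => // n IHn u.
rewrite ltnS => un; have wu := vseq_nbw H v0 u; have lu := vend_last H v0 u.
case/lastP uE : (vseq H v0 u) => [|w a].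
  by exists 0%N => /=; apply: vseq_inj; rewrite x0 uE.
have ww : nbw H (inl v0) w by move: wu; rewrite uE => /nbw_rcons.
have wsu : sadj w (vseq H v0 u) by left; exists a.
have := sadj_incidence _ _ _ _ ww wu wsu; rewrite lu.
case wl : (last (inl v0) w) => [//|e] _.
case/lastP : w => [//|p b] in ww wl wsu uE *.
have wp : nbw H (inl v0) p by exact: nbw_rcons ww.
have psw : sadj (rcons p b) p by right; exists b.
have := sadj_incidence _ _ _ _ ww wp psw; rewrite wl.
case pl : (last (inl v0) p) => [v|//] _.
have [u' u'E _] := vseq_ex _ _ _ _ wp pl.
have [|k xk] := IHn u'.
  by apply: leq_trans un; rewrite uE u'E !size_rcons.
exists k.+1 => /=; exists u'; split => //; right.
apply/coverP; split; first by rewrite u'E uE => /(congr1 size); rewrite !size_rcons; lia.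
by exists (rcons p b), e; split => //; rewrite u'E.
Qed.

Lemma cover_reroot v0 (u : hvert (universal_cover H v0)) x :
  vseq H (vend H v0 u) x = [::] ->
  adj_iso (universal_cover H (vend H v0 u)) (universal_cover H v0) x u.
Proof.
set v1 := vend H v0 u => x0.
have [f [g [[fP fh] [gP gh] f0]]] := reroot_walk H _ _ (vseq_nbw H v0 u).
rewrite vend_last -/v1 in fP fh gP gh.
have /choice[F FP] : forall p, exists q, vseq H v0 q = f (vseq H v1 p).
  move=> p; have [fp _ lp] := fP _ (vseq_nbw H v1 p).
  by rewrite vend_last in lp; have [q qE _] := vseq_ex _ _ _ _ fp lp; exists q.
have /choice[K KP] : forall p, exists q, vseq H v1 q = g (vseq H v0 p).
  move=> p; have [fp _ lp] := gP _ (vseq_nbw H v0 p).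
  by rewrite vend_last in lp; have [q qE _] := vseq_ex _ _ _ _ fp lp; exists q.
exists F, K; split.
- move=> p; apply: vseq_inj; rewrite KP FP.
  by case: (fP _ (vseq_nbw H v1 p)).
- move=> p; apply: vseq_inj; rewrite FP KP.
  by case: (gP _ (vseq_nbw H v0 p)).
- by apply: vseq_inj; rewrite FP x0.
- move=> p q /coverP[pq [w [e [ww we wp wq]]]]; apply/coverP; rewrite !FP.
  have [fw gfw lw] := fP _ ww.
  have [fp gfp _] := fP _ (vseq_nbw H v1 p); have [fq gfq _] := fP _ (vseq_nbw H v1 q).
  split; first by move/(congr1 g); rewrite gfp gfq.
  exists (f w), e; split; rewrite ?lw//; apply: fh => //; exact: vseq_nbw.
- move=> p q /coverP[pq [w [e [ww we wp wq]]]]; apply/coverP; rewrite !KP.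
  have [fw gfw lw] := gP _ ww.
  have [fp gfp _] := gP _ (vseq_nbw H v0 p); have [fq gfq _] := gP _ (vseq_nbw H v0 q).
  split; first by move/(congr1 f); rewrite gfp gfq.
  exists (g w), e; split; rewrite ?lw//; apply: gh => //; exact: vseq_nbw.
Qed.

Lemma cover_witness (R : realType) v0 (c : R) x : vseq H v0 x = [::] ->
  ~ form_bound R (universal_cover H v0) c ->
  exists r, local_witness R (universal_cover H v0) c r x.
Proof.
move=> x0 /existsNP[s /existsNP[f /not_implyP[us /negP]]]; rewrite -ltNge => lt1.
have [r rP] : exists r, forall u, u \in s -> reach (hadj (universal_cover H v0)) r x u.
  elim: s {us lt1} => [|u s [r rP]]; first by exists 0%N.
  have [k uk] := cover_reach v0 x u x0; exists (maxn k r) => v.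
  rewrite inE => /predU1P[->|/rP vr].
    exact: reach_le (leq_maxl _ _) uk.
  exact: reach_le (leq_maxr _ _) vr.
by exists r, s, f.
Qed.

(* The rerooted covers are indexed by the finite set [V], so a maximal radius exists. *)
Lemma uniform_witness (R : realType) v0 (c : R) : hconnected H ->
  ~ form_bound R (universal_cover H v0) c ->
  exists r, forall u, local_witness R (universal_cover H v0) c r u.
Proof.
move=> cH nb.
have /choice[r rP] : forall v, exists r, forall x, vseq H v x = [::] ->
    local_witness R (universal_cover H v) c r x.
  move=> v; have [u uv] := vend_surj H v0 cH v.
  have [x x0 _] := cover_root v.
  have xu := cover_reroot v0 u; rewrite uv in xu.
  have nbv : ~ form_bound R (universal_cover H v) c.
    move=> bv; apply: nb; apply: adj_iso_form_bound bv.
    exact: adj_iso_sym (xu x x0).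
  have [r rP] := cover_witness R v c x x0 nbv; exists r => y y0.
  by have -> : y = x by apply: vseq_inj; rewrite x0.
exists (\max_v r v) => u; have [x x0 _] := cover_root (vend H v0 u).
apply: local_witness_iso (cover_reroot v0 u x x0) _.
have [s [f [us sr lt1]]] := rP _ x x0; exists s, f; split => // w /sr.
exact/reach_le/leq_bigmax.
Qed.

Lemma card_reach_le (D : nat) (u : V) k :
  (forall u, #|[set v | (v != u) && `[< edge_adj u v >]]%SET| <= D)%N ->
  (#|[set v | `[< reach edge_adj k u v >]]%SET| <= D.+1 ^ k)%N.
Proof.
move=> deg; elim: k => [|k IHk].
  rewrite expn0 -(cards1 u); apply: subset_leq_card; apply/fintype.subsetP => v.
  rewrite inE => /asboolP /= <-; exact: set11.
pose B := [set v | `[< reach edge_adj k u v >]]%SET.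
pose N w := (w |: [set v | (v != w) && `[< edge_adj w v >]])%SET.
apply: (@leq_trans #|\bigcup_(w in B) N w|%SET).
  apply: subset_leq_card; apply/fintype.subsetP => v; rewrite inE => /asboolP[w [uw wv]].
  apply/bigcupP; exists w; first by rewrite inE; exact/asboolP.
  rewrite !inE; case: eqVneq => //= vw; apply/asboolP.
  by case: wv => // wv; rewrite wv eqxx in vw.
apply: (@leq_trans (\sum_(w in B) D.+1)%N); last by rewrite sum_nat_const expnSr leq_mul2r IHk orbT.
apply: (@leq_trans (\sum_(w in B) #|N w|)%N).
  elim/big_rec2: _ => [|w m A _ le1]; first by rewrite cards0.
  by rewrite (leq_trans (leq_card_setU _ _))// leq_add2l.
apply: leq_sum => w _; rewrite (leq_trans (leq_card_setU _ _))// cards1 add1n ltnS.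
exact: deg.
Qed.

End CoverGeometry.

(** Bounds degrees in [H] by data of the reference [H'] alone: distinct neighbours of [u] lift to
    distinct neighbours of one lift [u1], and the isomorphism carries these to the cover of [H']. *)
Lemma base_degree_le (V E V' E' : finType) (H : E -> {set V}) (H' : E' -> {set V'})
    v0 v0' x y (u : V) : hconnected H ->
  adj_iso (universal_cover H v0) (universal_cover H' v0') x y ->
  (#|[set v | (v != u) && `[< edge_adj H u v >]]%SET| <= #|E'| * #|V'|)%N.
Proof.
move=> cH [f [g [fg gf _ fh gh]]]; have [u1 u1u] := vend_surj H v0 cH u.
set N := finset _.
have /choice[l lP] : forall v, exists w, v \in N ->
    vend H v0 w = v /\ hadj (universal_cover H v0) u1 w.
  move=> v; case: (boolP (v \in N)) => [|_]; last by exists u1.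
  rewrite inE => /andP[vu /asboolP[e [ue ve]]].
  have [||w wv uw] := cover_lift H v0 u1 v e _ ve.
  - by rewrite u1u.
  - by rewrite u1u eq_sym.
  by exists w.
pose s := [seq f (l v) | v <- enum N].
have us : uniq s.
  rewrite map_inj_in_uniq ?enum_uniq// => v v'; rewrite !mem_enum => /lP[lv _] /lP[lv' _].
  by move/(can_inj fg) => ll; rewrite -lv -lv' ll.
rewrite cardE -(size_map (fun v => f (l v))) -/s.
apply: leq_trans (cover_degree H' v0' (f u1) s us).
rewrite leq_eqVlt eq_sym -all_count; apply/orP; left.
apply/allP => _ /mapP[v + ->]; rewrite mem_enum => /lP[_ ulv].
by apply/asboolP; exact: fh.
Qed.

(** The witness around the image of a lift [u1] of [u] is transported to the cover of [H] and pushed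
    down. Projection sends adjacent vertices into a common edge, so it does not increase
    distances. *)
Lemma base_witness (R : realType) (V E : finType) (H : E -> {set V}) (v0 : V)
    (T : hypergraph) x y (c : R) (r : nat) (u : V) : hconnected H ->
  adj_iso (universal_cover H v0) T x y ->
  (forall t, local_witness R T c r t) ->
  exists F : V -> R, [/\ exists v, F v != 0,
    forall v, F v != 0 -> reach (edge_adj H) r u v &
    c * \sum_v F v ^+ 2 <= qform H F].
Proof.
move=> cH [f [g [fg gf _ fh gh]]] wit; have [u1 u1u] := vend_surj H v0 cH u.
have iso1 : adj_iso T (universal_cover H v0) (f u1) u1 by exists g, f; split.
have [s [h [us sr lt1]]] := local_witness_iso _ _ _ _ _ _ _ iso1 (wit (f u1)).
have le1 := push_form_le H v0 s h us.
exists (push H v0 s h); split.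
(* If the push vanished, the strict inequality of the witness would read [0 < 0]. *)
- apply: contrapT => /forallNP F0; suff : (0 : R) < 0 by rewrite ltxx.
  have {}F0 v : push H v0 s h v = 0 by apply/eqP/negPn/negP; exact: F0.
  move: (lt_le_trans lt1 le1); rewrite -push_sqnorm /qform.
  by rewrite !big1 ?mulr0// => v _; rewrite F0 ?expr0n ?mul0r.
- move=> v /push_support[w /sr u1w <-]; rewrite -u1u.
  apply: reach_map u1w => a b /cover_step[e [_ [_ _ _ [ae be] _]]].
  by exists e.
- by rewrite push_sqnorm (le_trans (ltW lt1)).
Qed.

Lemma hlambda2_eventually (R : realType) (V0 E0 : finType) (H0 : E0 -> {set V0})
    (w0 : V0) (c : R) : hconnected H0 ->
  ~ form_bound R (universal_cover H0 w0) c ->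
  exists N, forall (V E : finType) (H : E -> {set V}) (v0 : V) x y,
    hconnected H -> adj_iso (universal_cover H v0) (universal_cover H0 w0) x y ->
    (N < #|V|)%N -> c <= hlambda R H 2.
Proof.
move=> cH0 nb; have [r wit] := uniform_witness H0 R w0 c cH0 nb.
(* A size bound for balls of radius [r + 1 + r]: beyond it some [u'] is so far from [v0] that the
   balls of radius [r] around the two are disjoint and joined by no edge. *)
exists ((#|E0| * #|V0|).+1 ^ (r + 1 + r))%N => V E H v0 x y cH iso.
move=> ltV.
have deg u := base_degree_le _ _ _ _ H H0 v0 w0 x y u cH iso.
have := leq_ltn_trans (card_reach_le H _ v0 (r + 1 + r) deg) ltV.
set B := finset _ => ltB.
have [u' u'B] : exists u', u' \notin B.
  apply: contrapT => /forallNP all; move: ltB; rewrite -cardsT.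
  suff -> : B = [set: V]%SET by rewrite ltnn.
  by apply/setP => v; rewrite finset.in_setT; apply/negPn/negP; exact: all.
have far : ~ reach (edge_adj H) (r + 1 + r) v0 u'.
  by move=> h; move: u'B; rewrite inE => /negP; apply; exact/asboolP.
have [F [F0 Fr Fq]] := base_witness R _ _ H v0 _ x y c r v0 cH iso wit.
have [F' [F'0 F'r F'q]] := base_witness R _ _ H v0 _ x y c r u' cH iso wit.
have cross u v : reach (edge_adj H) 1 u v -> F u * F' v = 0.
  move=> uv; apply: contrapT => /eqP; rewrite mulf_eq0 negb_or => /andP[/Fr ur /F'r vr].
  apply: far; apply: reach_trans (reach_trans _ _ _ _ _ _ ur uv) _.
  by apply: reach_sym vr; exact: edge_adj_sym.
apply: (hlambda2_ge_far H c F F') => // [v|e u v ue ve].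
  by apply: cross; exists v; split => //; left.
by apply: cross; apply: reach1; exists e.
Qed.

(** * The least form bound and the error function *)

Lemma form_bound_ge0 (R : realType) (G : hypergraph) (u : hvert G) (c : R) :
  form_bound R G c -> 0 <= c.
Proof.
move=> /(_ [:: u] (fun=> 1) isT); rewrite !big_seq1 big_cons big_nil expr1n mulr1.
by case: asboolP => [[//]|_]; rewrite mulr1.
Qed.

(** For each [f] the inequality is closed in [c], so it survives passing to the infimum. *)
Lemma form_bound_inf (R : realType) (G : hypergraph) :
  (exists c, form_bound R G c) -> form_bound R G (inf [set c | form_bound R G c]).
Proof.
move=> [c0 c0G] s f us; set S := \sum_(w <- s) f w ^+ 2.
have S0 : 0 <= S by rewrite sumr_ge0// => w _; rewrite sqr_ge0.
have [S0'|Sp] := eqVneq S 0; first by have := c0G s f us; rewrite -/S S0' !mulr0.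
have {}Sp : 0 < S by rewrite lt_def Sp.
rewrite -ler_pdivrMr//; apply: lb_le_inf; first by exists c0.
by move=> c cG; rewrite ler_pdivrMr//; exact: cG.
Qed.

(** The error is chosen from [d] and [T] before [H], so it is uniform over the [d]-regular
    hypergraphs with cover [T]. *)
Theorem theorem1p5 (R : realType) (d : nat) (T : hypergraph) :
  exists o : nat -> R,
    o n @[n --> \oo] --> (0 : R) /\
    forall (V E : finType) (H : E -> {set V}) (v0 : V),
      hconnected H -> hregular H d -> (2 <= #|V|)%N ->
      hiso (universal_cover H v0) T ->
      (((hlambda R H 2)%:E : \bar R) >=
        spectral_radius R (universal_cover H v0) - (o #|V|)%:E)%E.
Proof.
(* One [H0] with cover [T] serves as reference; if there is none, the bound is vacuous and the zero
   error works. *)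
have [[V0 [E0 [H0 [w0 [cH0 iso0]]]]]|none] := pselect (exists (V E : finType)
  (H : E -> {set V}) (v0 : V), hconnected H /\ hiso (universal_cover H v0) T); last first.
  exists (fun=> 0); split; first exact: cvg_cst.
  by move=> V E H v0 cH _ _ iso; case: none; exists V, E, H, v0.
set C0 := universal_cover H0 w0 in iso0 *.
have [x0 _ _] := cover_root H0 w0.
have isoP (V E : finType) (H : E -> {set V}) v0 : hiso (universal_cover H v0) T ->
    exists x y, adj_iso (universal_cover H v0) C0 x y.
  move=> iso; have [t xt] := hiso_adj_iso _ _ x0 iso0.
  have [x _ _] := cover_root H v0.
  have [t' xt'] := hiso_adj_iso _ _ x iso.
  move: xt => [f [g [fg gf _ fh gh]]]; exists x, (g t').
  by apply: adj_iso_trans xt' _; exists g, f; split.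
pose mu := inf [set c | form_bound R C0 c].
have mub : form_bound R C0 mu.
  by apply: form_bound_inf; exists (#|E0| * #|V0|)%:R; exact: cover_form_bound.
have mu0 : 0 <= mu by exact: form_bound_ge0 mub.
have nmu e : 0 < e -> ~ form_bound R C0 (mu - e).
  move=> e0 h; suff : mu <= mu - e by lra.
  by apply: ge_inf => //; exists 0 => c; exact: form_bound_ge0.
(* The deficits [mu - lambda_2] of all admissible [H] on [n] vertices; the extra element 0 makes the
   set nonempty and its supremum nonnegative. *)
pose X n := [set z : R | z = 0 \/ exists (V E : finType) (H : E -> {set V}) (v0 : V),
  [/\ hconnected H, hregular H d, (2 <= #|V|)%N, hiso (universal_cover H v0) T &
      #|V| = n /\ z = mu - hlambda R H 2]].
have X0 n : X n 0 by left.
have Xub n : has_ubound (X n).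
  exists (mu + (d * n)%:R) => z [->|[V [E [H [v0 [_ Hd V2 _ [<- ->]]]]]]].
    by rewrite addr_ge0.
  by rewrite lerD2l lerNl; exact: hlambda2_lower_bound.
exists (fun n => sup (X n)); split; last first.
  move=> V E H v0 cH Hd V2 iso.
  have [x [y xy]] := isoP _ _ _ _ iso.
  have bC := adj_iso_form_bound _ _ _ _ _ _ xy mub.
  have rad := spectral_radius_cover_le H v0 mu mu0 bC.
  have le1 : mu - hlambda R H 2 <= sup (X #|V|).
    by apply: ub_le_sup => //; right; exists V, E, H, v0.
  apply: le_trans (_ : (mu%:E - (sup (X #|V|))%:E)%E <= _)%E; first exact: leeB.
  by rewrite -EFinB lee_fin lerBlDr -lerBlDl.
(* As [mu - e] is not a form bound, [lambda_2 >= mu - e] for every large [H], so all elements of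
   [X n] are at most [e]. *)
apply/cvgrPdist_le => e e0; have [N NP] := hlambda2_eventually R _ _ H0 w0 _ cH0 (nmu e e0).
exists N.+1 => // n /= Nn; rewrite sub0r normrN ger0_norm; last exact: ub_le_sup.
apply: ge_sup; first by exists 0.
move=> z [->|[V [E [H [v0 [cH Hd V2 iso [Vn ->]]]]]]]; first exact: ltW.
have [x [y xy]] := isoP _ _ _ _ iso.
have := NP _ _ H v0 x y cH xy; rewrite Vn => /(_ Nn).
by rewrite lerBlDr addrC lerBlDr.
Qed.
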